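(* Let $\alpha\in(0,1)$ and let $q:[0,+\infty)\to\mathbb{R}$ be a continuous function such that, for some real $\varepsilon>2$ and some $t_0>0$, $$\limsup_{t\to+\infty}\frac{1}{t^{\varepsilon}}\int_{t_0}^{t}(t-s)^{\varepsilon}q(s)\,ds=+\infty .$$ Then any solution $x$ of the fractional differential equation $$\left(x^{(\alpha)}\right)'(t)+q(t)x(t)=0,\qquad t\in(0,+\infty),$$ where $x^{(\alpha)}$ denotes the Caputo derivative of order $\alpha$ of $x$, either oscillates or satisfies the inequality $$\liminf_{t\to+\infty}\left\{x^{(\alpha)}(t)\cdot\left[x'(t)-x^{(\alpha)}(t)\right]\right\}\leq 0 .$$ More precisely, in the situation where this last inequality holds, there is an increasing, unbounded from above, sequence $(T_n)_{n\geq1}\subset(0,+\infty)$ such that $$x^{(\alpha)}(T_n)\cdot\left[x'(T_n)-x^{(\alpha)}(T_n)\right]<0,\qquad n\geq1 .$$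
   Context: For $\alpha\in(0,1)$ and a function $h\in C^{1}((0,+\infty),\mathbb{R})\cap C([0,+\infty),\mathbb{R})$ such that $\lim_{t\searrow0}[t^{1-\alpha}h'(t)]$ exists in $\mathbb{R}$ (in particular for $h\in C^{1}([0,+\infty),\mathbb{R})$), the Caputo derivative of order $\alpha$ of $h$ is $$h^{(\alpha)}(t)=\frac{1}{\Gamma(1-\alpha)}\int_{0}^{t}\frac{h'(s)}{(t-s)^{\alpha}}\,ds,\qquad t\in(0,+\infty),$$ where $\Gamma$ is Euler's Gamma function. A solution of the equation $\left(x^{(\alpha)}\right)'(t)+q(t)x(t)=0$ is any function $x\in C^{1}([0,+\infty),\mathbb{R})$ that verifies the equation in $(0,+\infty)$. A solution $x$ oscillates if there exists an increasing, unbounded from above, sequence $(t_n)_{n\geq1}\subset(0,+\infty)$ such that $x(t_{2n-1})<0$ and $x(t_{2n})>0$ for all $n\geq1$.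
   Formalization: The final clause on the sequence (T_n) is stated only for solutions x not identically zero on [0,+∞), since for x = 0 the liminf is 0 but no T_n with a strictly negative value exists; the dichotomy itself is stated for all solutions. *)

(* Defs.v *)
From HB Require Import structures.
From mathcomp Require Import all_boot all_order all_algebra.
From mathcomp Require Import all_classical all_reals all_analysis.

Set Implicit Arguments.
Unset Strict Implicit.
Unset Printing Implicit Defensive.

Import Order.TTheory GRing.Theory Num.Theory.
Import numFieldNormedType.Exports.

Local Open Scope classical_set_scope.
Local Open Scope ring_scope.

(* A function on [0, +oo[ is represented by a function R -> R whose values at
   negative arguments are irrelevant. *)

Definition Gamma {R : realType} (z : R) : R :=
  \int[lebesgue_measure]_(s in `]0, +oo[) (s `^ (z - 1) * expR (- s)).

(* The endpoints do not matter for the integral: in particular the value of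
   h' at 0, where only a one-sided derivative makes sense, is not used. *)
Definition caputo {R : realType} (alpha : R) (h : R -> R) (t : R) : R :=
  (Gamma (1 - alpha))^-1 *
  \int[lebesgue_measure]_(s in `]0, t[) (derive1 h s / (t - s) `^ alpha).

(* C^1([0, +oo[): the difference quotients are restricted to [0, +oo[, so the
   derivative is the right one at 0 and the ordinary one at t > 0. *)
Definition C1_halfline {R : realType} (x : R -> R) : Prop :=
  exists dx : R -> R,
    {within `[0, +oo[, continuous dx} /\
    forall t : R, 0 <= t ->
      (x s - x t) / (s - t) @[s --> within `[0, +oo[ t^'] --> dx t.

Definition is_solution {R : realType} (alpha : R) (q x : R -> R) : Prop :=
  C1_halfline x /\
  forall t : R, 0 < t ->
    derivable (caputo alpha x) t 1 /\
    derive1 (caputo alpha x) t + q t * x t = 0.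

Definition increasing_unbounded {R : realType} (T : nat -> R) : Prop :=
  [/\ forall n, 0 < T n, {homo T : m n / (m < n)%N >-> m < n}
    & ~ has_ubound (range T)].

(* Sequences start at index 0, so the terms of odd rank are the T n.*2. *)
Definition oscillates {R : realType} (x : R -> R) : Prop :=
  exists T : nat -> R,
    increasing_unbounded T /\
    forall n, x (T n.*2) < 0 /\ 0 < x (T n.*2.+1).

(* Main.v *)
Require Import Defs.
From HB Require Import structures.
From mathcomp Require Import all_boot all_order all_algebra.
From mathcomp Require Import all_classical all_reals all_analysis.
From mathcomp Require Import measurable_realfun.
From mathcomp Require Import ring lra.

Set Implicit Arguments.
Unset Strict Implicit.
Unset Printing Implicit Defensive.

Import Order.TTheory GRing.Theory Num.Theory.
Import numFieldNormedType.Exports.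

Local Open Scope classical_set_scope.
Local Open Scope ring_scope.

(** Write u for the Caputo derivative of x, so that u' = - q x, and suppose that
    x is nonnegative and u (x' - u) >= 0 on a half-line.

    If x is eventually positive, w = u / x satisfies w' <= - q - w^2.  Integrating
    (t - s)^eps q(s) against this and completing the square bounds the averages
    of q by a constant, which contradicts the hypothesis on the limsup.

    Otherwise x has arbitrarily large zeros, at which x = x' = u = 0; also u = 0
    at every local maximum.  The condition u(c) = 0 says that x(c) is the average
    of the past values of x, extended by x(0) to negative times, with the weight
    (c - s)^(- alpha - 1).  If x(0) > 0, the average at a late zero is positive,
    which is absurd.  If x(0) < 0, moving from a late zero b to a later c
    decreases the relative weight of the recent, nonnegative, past, so the average
    at c is negative and c is neither a zero nor a positive local maximum.
    Finally, x(0) = 0 forces x = 0: at the maximum c of |x(s)| e^(- lam s) on a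
    compact interval |u(c)| is at least of the order of |x(c)|, whereas
    u' = - q x gives |u(c)| = O(|x(c)| / lam). *)

(** * Integrals and antiderivatives *)

Lemma integrable_scale (R : realType) (f : R -> R) (k a b : R) :
  lebesgue_measure.-integrable `[a, b] (EFin \o f) ->
  lebesgue_measure.-integrable `[a, b] (EFin \o (fun s => k * f s)).
Proof.
move=> intf.
rewrite (_ : _ \o _ = fun s => (k%:E * (EFin \o f) s)%E); last exact/funext.
exact: integrableZl.
Qed.

(** [F] minus the running integral [I] of [f] is continuous on the closed interval and has a
    nonnegative derivative inside. At the end points [f] is only integrable, so kernels singular at
    [b] are covered. *)
Lemma Rintegral_le_antiderivative (R : realType) (f F dF : R -> R) (a b : R) :
  a < b -> lebesgue_measure.-integrable `[a, b] (EFin \o f) ->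
  {in `]a, b[, continuous f} -> {within `[a, b], continuous F} ->
  (forall s, a < s < b -> is_derive s 1 F (dF s)) ->
  (forall s, a < s < b -> f s <= dF s) ->
  \int[lebesgue_measure]_(s in `[a, b]) f s <= F b - F a.
Proof.
move=> ab intf cf cF dFE fF.
pose I x := \int[lebesgue_measure]_(s in `[a, x]) f s.
have dI s : a < s < b -> is_derive s 1 I (f s).
  move=> /andP[as_ sb].
  have cfs : {for s, continuous f} by apply: cf; rewrite in_itv/= as_.
  have [dI <-] := @continuous_FTC1_closed R f a s b sb intf as_ cfs.
  by rewrite derive1E; exact: DeriveDef.
have cI : {within `[a, b], continuous I}.
  exact: (parameterized_integral_continuous (ltW ab) intf).
pose g := F \- I.
have dg s : a < s < b -> is_derive s 1 g (dF s - f s).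
  by move=> sab; apply: is_deriveB; [exact: dFE|exact: dI].
have : g a <= g b.
  apply: (@ger0_derive1_ndecr R g a b) => //; try exact: ltW.
  - by move=> s; rewrite in_itv/= => /dg [].
  - move=> s; rewrite in_itv/= => sab; rewrite derive1E.
    by have [_ ->] := dg _ sab; rewrite subr_ge0 fF.
  - by move=> s; apply: cvgB; [exact: cF|exact: cI].
rewrite /g /= /I set_itv1 Rintegral_set1 subr0; lra.
Qed.

Lemma Rintegral_ge_antiderivative (R : realType) (f F dF : R -> R) (a b : R) :
  a < b -> lebesgue_measure.-integrable `[a, b] (EFin \o f) ->
  {in `]a, b[, continuous f} -> {within `[a, b], continuous F} ->
  (forall s, a < s < b -> is_derive s 1 F (dF s)) ->
  (forall s, a < s < b -> dF s <= f s) ->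
  F b - F a <= \int[lebesgue_measure]_(s in `[a, b]) f s.
Proof.
move=> ab intf cf cF dFE fF.
have : \int[lebesgue_measure]_(s in `[a, b]) (- 1 * f s) <= - F b - - F a.
  apply: (@Rintegral_le_antiderivative _ _ (fun s => - F s) (fun s => - dF s)) => //.
  - exact: integrable_scale.
  - move=> s sab; apply: cvgM; [exact: cvg_cst|exact: cf].
  - by move=> s; apply: cvgN; exact: cF.
  - by move=> s sab; apply: is_deriveN; exact: dFE.
  - by move=> s sab; rewrite mulN1r lerN2 fF.
rewrite RintegralZl//; lra.
Qed.

Lemma integrable_itv_oo_cc (R : realType) (f : R -> R) (a b : R) : a < b ->
  lebesgue_measure.-integrable `]a, b[ (EFin \o f) ->
  lebesgue_measure.-integrable `[a, b] (EFin \o f).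
Proof.
move=> ab intf.
have DN : `[a, b]%classic `\` [set a; b] = `]a, b[%classic :> set R.
  apply/seteqP; split => s; rewrite /= !in_itv/=.
    by move=> [/andP[sa sb] /not_orP[/eqP na /eqP nb]]; rewrite !lt_neqAle eq_sym na nb sa.
  move=> /andP[sa sb]; split; first by rewrite !ltW.
  by move=> [] seq; move: sa sb; rewrite seq ltxx.
have := @negligible_integrable _ (measurableTypeR R) R (@lebesgue_measure R)
  `[a, b]%classic [set a; b] (EFin \o f).
case=> //; last (by move=> _; rewrite DN; apply).
- exact: measurableU.
- case/integrableP: intf => + _ => /measurable_EFinP mf; apply/measurable_EFinP.
  by apply/measurable_fun_itv_bndo_bndcP/measurable_fun_itv_obnd_cbndP.
- apply/eqP; rewrite eq_le measure_ge0 andbT.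
  apply: (le_trans (measureU2 _ _ _)) => //.
  by rewrite -[leRHS]adde0; apply: leeD; rewrite le_eqVlt; apply/orP; left;
    apply/eqP; exact: lebesgue_measure_set1.
Qed.

(** By monotone convergence along closed intervals exhausting ]a, b[: on each of them the integral
    is an increment of [F], hence at most [F b - F a]. *)
Lemma integrable_ge0_antiderivative (R : realType) (f F : R -> R) (a b : R) :
  a < b -> {in `]a, b[, continuous f} -> {within `[a, b], continuous F} ->
  (forall s, a < s < b -> is_derive s 1 F (f s)) ->
  (forall s, a < s < b -> 0 <= f s) ->
  lebesgue_measure.-integrable `]a, b[ (EFin \o f).
Proof.
move=> ab cf cF dF f0.
have mf : measurable_fun `]a, b[ f.
  apply: open_continuous_measurable_fun => // s; rewrite inE/= => sab.
  by apply: cf.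
(* A third of the length keeps every [E n] nondegenerate, including [E 0]. *)
pose h := (b - a) / 3; have h0 : 0 < h by rewrite /h; lra.
pose E n : set R := `[a + h / n.+1%:R, b - h / n.+1%:R]%classic.
have hn n : 0 < h / n.+1%:R <= h.
  by rewrite divr_gt0//= ler_pdivrMr// ler_peMr ?ler1n// ltW.
have EE : \bigcup_n E n = `]a, b[%classic :> set R.
  apply/seteqP; split => [s [n _]|s]; rewrite ?/E/= !in_itv/=.
    by move: (h / n.+1%:R) (hn n) => d /andP[? ?] /andP[? ?]; apply/andP; split; lra.
  move=> /andP[sa sb]; pose m := Num.min (s - a) (b - s).
  have m0 : 0 < m by rewrite lt_min !subr_gt0 sa.
  have [n nm] : exists n : nat, h / n.+1%:R <= m.
    exists (Num.truncn (h / m)).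
    rewrite ler_pdivrMr// mulrC -ler_pdivrMr// ltW//.
    exact: truncnS_gt.
  exists n => //=; rewrite /E/= in_itv/=.
  by move: nm; rewrite le_min; move: (h / n.+1%:R) => d /andP[? ?]; apply/andP; split; lra.
have Esub n : E n `<=` `]a, b[%classic by rewrite -EE; exact: bigcup_sup.
apply/integrableP; split; first exact/measurable_EFinP.
have cvgE : (\int[lebesgue_measure]_(x in E n) (EFin \o f) x)%E @[n --> \oo]
    --> (\int[lebesgue_measure]_(x in `]a, b[) (EFin \o f) x)%E.
  rewrite -EE; apply: ge0_nondecreasing_set_cvg_integral.
  - move=> n m nm; apply/subsetPset => s; rewrite /E/= !in_itv/=.
    have : h / m.+1%:R <= h / n.+1%:R.
      by rewrite ler_pM2l// lef_pV2 ?posrE// ler_nat ltnS.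
    by move: (h / n.+1%:R) (h / m.+1%:R) => d e ? /andP[? ?]; apply/andP; split; lra.
  - by move=> n; exact: measurable_itv.
  - move=> n; apply/measurable_EFinP; apply: measurable_funS mf => //.
  - by move=> n s /Esub /=; rewrite in_itv/= lee_fin => /f0.
apply: (@le_lt_trans _ _ (F b - F a)%:E); last exact: ltry.
rewrite [leLHS](_ : _ = \int[lebesgue_measure]_(x in `]a, b[) (EFin \o f) x)%E; last first.
  by apply: eq_integral => s; rewrite inE/= in_itv/= => sab; rewrite ger0_norm// f0.
rewrite -(cvg_lim _ cvgE)//.
have Fmono : forall x y, a <= x -> x <= y -> y <= b -> F x <= F y.
  apply: ger0_derive1_ndecr => //.
  - by move=> s; rewrite in_itv/= => /dF [].
  - by move=> s; rewrite in_itv/= => sab; rewrite derive1E; have [_ ->] := dF _ sab; exact: f0.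
apply: lime_le; first by apply/cvg_ex; eexists; exact: cvgE.
apply: nearW => n; rewrite /E /=.
have := @Esub n; rewrite /E; move: (h / n.+1%:R) (hn n) => d /andP[d0 dh] {}Esub.
have anbn : a + d < b - d by rewrite /h in dh; lra.
rewrite (@continuous_FTC2 _ f F)//.
- rewrite -EFinB lee_fin; have := @Fmono a (a + d); have := @Fmono (b - d) b.
  lra.
- apply: continuous_in_subspaceT => s; rewrite inE => /Esub; exact: cf.
- apply: (@derivable_oo_continuousW _ _ a b) => //.
    by move=> s /Esub /=; rewrite !in_itv/= => /andP[? ?]; rewrite !ltW.
  have [_ Fa Fb] := (continuous_within_itvP F ab).1 cF.
  by split => // s; rewrite in_itv/= => /dF [].
- move=> s; rewrite in_itv/= => sab; rewrite derive1E.
  have sab' : a < s < b by lra.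
  by have [_ ->] := dF _ sab'.
Qed.

(** * Derivative rules and powers of c - s *)

Lemma powRD_gt0 (R : realType) (x r s : R) : 0 < x ->
  x `^ (r + s) = x `^ r * x `^ s.
Proof. by move=> x0; rewrite powRD// (gt_eqF x0) implybT. Qed.

Lemma is_derive_mulE (R : realType) (f g : R -> R) (s df dg e : R) :
  is_derive s 1 f df -> is_derive s 1 g dg -> df * g s + f s * dg = e ->
  is_derive s 1 (fun s => f s * g s) e.
Proof.
move=> hf hg <-; have [h1 h2] := is_deriveM hf hg.
by split; [exact: h1|rewrite h2 /GRing.scale/= addrC (mulrC (g s))].
Qed.

Lemma is_derive_scaleE (R : realType) (f : R -> R) (k s df e : R) :
  is_derive s 1 f df -> k * df = e -> is_derive s 1 (fun s => k * f s) e.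
Proof.
move=> hf <-; apply: (is_derive_mulE (is_derive_cst k s 1) hf).
by rewrite mul0r add0r.
Qed.

Lemma is_derive_addE (R : realType) (f g : R -> R) (s df dg e : R) :
  is_derive s 1 f df -> is_derive s 1 g dg -> df + dg = e ->
  is_derive s 1 (fun s => f s + g s) e.
Proof. by move=> hf hg <-; exact: is_deriveD. Qed.

Lemma is_derive_continuous (R : realType) (f : R -> R) (s df : R) :
  is_derive s 1 f df -> {for s, continuous f}.
Proof.
by move=> [df' _]; apply: differentiable_continuous; exact/derivable1_diffP.
Qed.

Lemma is_derive_powRB (R : realType) (p c s : R) : s < c ->
  is_derive s 1 (fun s => (c - s) `^ p) (- (p * (c - s) `^ (p - 1))).
Proof.
move=> sc.
have h : is_derive s (1 : R) (fun s : R => c - s) (- 1).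
  by rewrite -[- 1]add0r; apply: is_deriveB.
have k : is_derive (c - s) (1 : R) (@powR R ^~ p) (p * (c - s) `^ (p - 1)).
  by apply: is_derive1_powR; rewrite subr_gt0.
have := @is_derive1_comp R (@powR R ^~ p) (fun s => c - s) s _ _ k h.
by rewrite mulrN1.
Qed.

Lemma continuous_powRB (R : realType) (p c s : R) : s < c ->
  {for s, continuous (fun s => (c - s) `^ p)}.
Proof.
move=> sc; apply: differentiable_continuous; apply/derivable1_diffP.
by have [] := is_derive_powRB p sc.
Qed.

Lemma cvg_powRB (R : realType) (p c : R) : 0 < p ->
  (c - s) `^ p @[s --> c^'-] --> (0 : R).
Proof.
move=> p0.
apply: (@decreasing_cvg_at_left_comp R (fun s => c - s) (@powR R ^~ p)
  (BLeft (c - 1)) c 0).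
- by rewrite bnd_simp; lra.
- by move=> y z _ _ yz; lra.
- by apply: cvg_at_left_filter; apply: cvgB; [exact: cvg_cst|exact: cvg_id].
- by rewrite subrr; exact: powR_cvg0.
Qed.

(** Only left continuity at [c] is at stake, and it follows by squeezing. Primitives of singular
    kernels are shown in this way to be continuous up to the singularity. *)
Lemma continuous_within_powR_bound (R : realType) (F : R -> R) (p a c M : R) :
  a < c -> 0 < p -> {in `[a, c[, continuous F} -> F c = 0 ->
  (forall s, a < s < c -> `|F s| <= M * (c - s) `^ p) ->
  {within `[a, c], continuous F}.
Proof.
move=> ac p0 cF Fc0 Fb; apply/continuous_within_itvP => //; split.
- move=> s; rewrite in_itv/= => /andP[? ?]; apply: cF; rewrite in_itv/=.
  by apply/andP; split => //; exact: ltW.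
- by apply: cvg_at_right_filter; apply: cF; rewrite in_itv/= lexx.
rewrite Fc0; apply/norm_cvg0P.
apply: (@squeeze_cvgr _ _ _ _ (fun=> 0) (fun s => M * (c - s) `^ p)).
- near=> s; rewrite normr_ge0 Fb//; apply/andP; split; near: s.
    exact: nbhs_left_gt.
  exact: nbhs_left_lt.
- exact: cvg_cst.
- by rewrite -(mulr0 M); apply: cvgMr; exact: cvg_powRB.
Unshelve. all: by end_near. Qed.

Lemma continuous_within_powRB (R : realType) (p a c : R) : a < c -> 0 < p ->
  {within `[a, c], continuous (fun s : R => (c - s) `^ p)}.
Proof.
move=> ac p0; apply: (@continuous_within_powR_bound R _ p a c 1) => //.
- by move=> s; rewrite in_itv/= => /andP[_ sc]; exact: continuous_powRB.
- by rewrite subrr powR0 ?gt_eqF.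
- by move=> s _; rewrite mul1r ger0_norm ?powR_ge0.
Qed.

Lemma integrable_powRB_continuousM (R : realType) (q : R -> R) (p a c : R) :
  a < c -> 0 < p -> continuous q ->
  lebesgue_measure.-integrable `[a, c] (EFin \o (fun s : R => (c - s) `^ p * q s)).
Proof.
move=> ac p0 cq; have cq' : {within `[a, c], continuous q} by exact: continuous_subspaceT.
apply: continuous_compact_integrable; first exact: segment_compact.
by move=> s; apply: cvgM; [exact: continuous_within_powRB|exact: cq'].
Qed.

(** Since alpha < 1, the primitive - (c - s)^(1 - alpha) / (1 - alpha) extends continuously by 0 at
    [c]. *)
Lemma integrable_powRB (R : realType) (alpha p c : R) : alpha < 1 -> p < c ->
  lebesgue_measure.-integrable `[p, c] (fun s : R => ((c - s) `^ (- alpha))%:E).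
Proof.
move=> a1 pc; have b0 : 0 < 1 - alpha by lra.
have dF s : p < s < c -> is_derive s 1
    (fun s => - (1 - alpha)^-1 * (c - s) `^ (1 - alpha)) ((c - s) `^ (- alpha)).
  move=> /andP[_ sc].
  apply: is_derive_scaleE (is_derive_powRB (1 - alpha) sc) _.
  rewrite (_ : 1 - alpha - 1 = - alpha); last by ring.
  field; lra.
apply: (@integrable_itv_oo_cc _ (fun s => (c - s) `^ (- alpha))) => //.
apply: (integrable_ge0_antiderivative pc _ _ dF).
- by move=> s; rewrite in_itv/= => /andP[_ sc]; exact: continuous_powRB.
- apply: (@continuous_within_powR_bound _ _ (1 - alpha) _ _ ((1 - alpha)^-1)) => //.
  + move=> s; rewrite in_itv/= => /andP[_ sc].
    by apply: cvgMr; exact: continuous_powRB.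
  + by rewrite subrr powR0 ?gt_eqF// mulr0.
  + by move=> s _; rewrite normrM normrN !ger0_norm// ?powR_ge0// invr_ge0 ltW.
- by move=> s _; exact: powR_ge0.
Qed.

(** * Abel integrals of a derivative *)

(** Half-line functions are to be extended by their value at 0. This keeps [x] and [dx] continuous
    on the whole line, while [dx] is the derivative of [x] only at positive times. *)
Definition C1_positive (R : realType) (x dx : R -> R) :=
  [/\ continuous x, continuous dx & forall t : R, 0 < t -> is_derive t 1 x (dx t)].

Lemma C1_positiveN (R : realType) (x dx : R -> R) :
  C1_positive x dx -> C1_positive (\- x) (\- dx).
Proof.
move=> [cx cdx xE]; split.
- by move=> t; apply: cvgN; exact: cx.
- by move=> t; apply: cvgN; exact: cdx.
- by move=> t t0; apply: is_deriveN; exact: xE.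
Qed.

Lemma continuous_itv_bounded (R : realType) (y : R -> R) (a b : R) : a <= b ->
  continuous y -> exists2 M : R, 0 <= M & forall s : R, a <= s <= b -> `|y s| <= M.
Proof.
move=> ab cy; have [|c _ yc] := @EVT_max R (fun s => `|y s|) a b ab.
  by apply: continuous_subspaceT => s; apply: cvg_norm; exact: cy.
by exists `|y c| => // s sab; apply: yc; rewrite in_itv.
Qed.

Lemma C1_positive_lipschitz (R : realType) (x dx : R -> R) (c : R) : 0 < c ->
  C1_positive x dx ->
  exists M : R, forall s : R, 0 <= s < c -> `|x s - x c| <= M * (c - s).
Proof.
move=> c0 [cx cdx xE].
have [M M0 Mb] := continuous_itv_bounded (ltW c0) cdx.
exists M => s /andP[s0 sc].
have [||r rsc xcs] := @MVT R x dx s c sc.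
- by move=> r; rewrite in_itv/= => /andP[? ?]; apply: xE; lra.
- exact: continuous_subspaceT.
move: rsc; rewrite in_itv/= => /andP[? ?].
rewrite distrC xcs normrM (gtr0_norm (x := c - s)) ?subr_gt0// ler_pM2r ?subr_gt0//.
by apply: Mb; apply/andP; split; lra.
Qed.

Lemma integrable_itv_continuousM (R : realType) (y k : R -> R) (a b : R) :
  continuous y -> lebesgue_measure.-integrable `[a, b] (EFin \o k) ->
  lebesgue_measure.-integrable `[a, b] (EFin \o (fun s => y s * k s)).
Proof.
move=> cy intk.
have [ba|ab] := ltP b a.
  by rewrite set_itv_ge ?bnd_simp -?ltNge//; exact: integrable_set0.
have [M M0 yM] := continuous_itv_bounded ab cy.
rewrite (_ : _ \o _ = (EFin \o y) \* (EFin \o k))%E; last exact/funext.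
apply: integrableMr => //.
  by apply: measurable_funS (continuous_measurable_fun cy).
exists M; split; first exact: num_real.
move=> N MN s /=; rewrite in_itv/= => sab.
exact: (le_trans (yM _ sab) (ltW MN)).
Qed.

Lemma integrable_abel (R : realType) (alpha : R) (y : R -> R) (a b c : R) :
  alpha < 1 -> a < c -> b <= c -> continuous y ->
  lebesgue_measure.-integrable `[a, b] (EFin \o (fun s => y s * (c - s) `^ (- alpha))).
Proof.
move=> a1 ac bc cy; apply: integrable_itv_continuousM => //.
apply: integrableS (integrable_powRB a1 ac) => //.
by move=> s /=; rewrite !in_itv/= => /andP[-> ?]; lra.
Qed.

Lemma Rintegral_itv_split (R : realType) (f : R -> R) (a p b : R) :
  a <= p -> p <= b -> lebesgue_measure.-integrable `[a, b] (EFin \o f) ->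
  \int[lebesgue_measure]_(s in `[a, b]) f s =
  \int[lebesgue_measure]_(s in `[a, p]) f s + \int[lebesgue_measure]_(s in `[p, b]) f s.
Proof.
move=> ap pb intf.
have -> : \int[lebesgue_measure]_(s in `[p, b]) f s = \int[lebesgue_measure]_(s in `]p, b]) f s.
  rewrite Rintegral_itv_obnd_cbnd//.
  apply: integrableS intf => //.
  by move=> s /=; rewrite !in_itv/= => /andP[? ->]; rewrite andbT; lra.
by rewrite -(@Rintegral_itvB R f (BLeft a) (BRight b) p) ?bnd_simp//; lra.
Qed.

(** (x - w) k is a primitive of dx k + (x - w) dk, whose second term is discarded by its sign
    instead of being integrated: for the kernels used, [dk] may be too singular at [T]. The constant
    [w] is chosen to fix this sign or to cancel a singular boundary term. *)
Lemma Rintegral_by_parts_ge (R : realType) (x dx k dk : R -> R) (w p T : R) :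
  0 <= p -> p < T -> C1_positive x dx ->
  lebesgue_measure.-integrable `[p, T] (EFin \o (fun s => dx s * k s)) ->
  (forall s, p < s < T -> is_derive s 1 k (dk s)) ->
  {within `[p, T], continuous (fun s => (x s - w) * k s)} ->
  (forall s, p < s < T -> (x s - w) * dk s <= 0) ->
  (x T - w) * k T - (x p - w) * k p <=
  \int[lebesgue_measure]_(s in `[p, T]) (dx s * k s).
Proof.
move=> p0 pT [cx cdx xE] intf kE cF Fle0.
apply: (@Rintegral_ge_antiderivative R _ (fun s => (x s - w) * k s)
  (fun s => dx s * k s + (x s - w) * dk s) _ _ pT intf) => //.
- move=> s; rewrite in_itv/= => pst; apply: cvgM; first exact: cdx.
  apply: differentiable_continuous; apply/derivable1_diffP.
  by have [] := kE _ pst.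
- move=> s pst; have s0 : 0 < s by lra.
  apply: is_derive_mulE (kE _ pst) _; last by [].
  by apply: is_derive_addE (xE _ s0) (is_derive_cst (- w) s 1) _; rewrite addr0.
- by move=> s /Fle0; lra.
Qed.

(** For y = x' and [c] positive this is the Caputo derivative of x at [c] without the factor 1 /
    Gamma(1 - alpha). *)
Definition abel_integral (R : realType) (alpha : R) (y : R -> R) (c : R) :=
  \int[lebesgue_measure]_(s in `[0, c]) (y s * (c - s) `^ (- alpha)).

Lemma is_derive_kernel (R : realType) (alpha c s : R) : s < c ->
  is_derive s 1 (fun s => (c - s) `^ (- alpha)) (alpha * (c - s) `^ (- alpha - 1)).
Proof.
move=> sc; apply: is_derive_eq; first exact: is_derive_powRB.
by rewrite mulNr opprK.
Qed.

(** The Lipschitz estimate at [c] bounds the product by M (c - s)^(1 - alpha), a positive power. *)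
Lemma kernel_primitive_continuous (R : realType) (alpha : R) (x dx : R -> R) (p c : R) :
  0 < alpha < 1 -> 0 <= p -> p < c -> C1_positive x dx ->
  {within `[p, c], continuous (fun s => (x s - x c) * (c - s) `^ (- alpha))}.
Proof.
move=> /[dup] halpha /andP[a0 a1] p0 pc xC1; have [cx _ _] := xC1.
have [M Mb] := C1_positive_lipschitz (le_lt_trans p0 pc) xC1.
apply: (@continuous_within_powR_bound R _ (1 - alpha) p c M) => //.
- lra.
- move=> s; rewrite in_itv/= => /andP[_ sc]; apply: cvgM; last exact: continuous_powRB.
  by apply: cvgB; [exact: cx|exact: cvg_cst].
- by rewrite subrr mul0r.
move=> s /andP[ps sc]; rewrite normrM (ger0_norm (powR_ge0 _ _)).
rewrite powRD_gt0 ?subr_gt0//.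
rewrite powRr1 ?subr_ge0 ?(ltW sc)// mulrA ler_wpM2r ?powR_ge0//.
by apply: Mb; lra.
Qed.

(* The boundary term at c vanishes because x(s) - x(c) = O(c - s) and alpha < 1. *)
Lemma abel_extremum (R : realType) (alpha : R) (x dx : R -> R) (p c : R) :
  0 < alpha < 1 -> 0 <= p -> p < c -> C1_positive x dx ->
  (forall s, p <= s <= c -> x s <= x c) ->
  (x c - x p) * (c - p) `^ (- alpha) <=
  \int[lebesgue_measure]_(s in `[p, c]) (dx s * (c - s) `^ (- alpha)).
Proof.
move=> /[dup] halpha /andP[a0 a1] p0 pc xC1 xmax; have [_ cdx _] := xC1.
have := @Rintegral_by_parts_ge R x dx (fun s => (c - s) `^ (- alpha))
  (fun s => alpha * (c - s) `^ (- alpha - 1)) (x c) p c p0 pc xC1.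
rewrite subrr mul0r sub0r -mulNr opprB; apply.
- exact: integrable_abel.
- by move=> s /andP[_ sc]; exact: is_derive_kernel.
- exact: (kernel_primitive_continuous halpha p0 pc xC1).
- move=> s /andP[ps sc]; rewrite mulr_le0_ge0 ?subr_le0 ?xmax ?(ltW ps) ?(ltW sc)//.
  by rewrite mulr_ge0 ?powR_ge0 ?ltW.
Qed.

Lemma abel_integral_split (R : realType) (alpha : R) (dx : R -> R) (p c : R) :
  0 < alpha < 1 -> 0 <= p -> p < c -> continuous dx ->
  abel_integral alpha dx c =
  \int[lebesgue_measure]_(s in `[0, p]) (dx s * (c - s) `^ (- alpha)) +
  \int[lebesgue_measure]_(s in `[p, c]) (dx s * (c - s) `^ (- alpha)).
Proof.
move=> /[dup] halpha /andP[a0 a1] p0 pc cdx; apply: Rintegral_itv_split => //; first exact: ltW.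
by apply: integrable_abel => //; lra.
Qed.

Lemma abel_ge_max (R : realType) (alpha : R) (x dx : R -> R) (c : R) :
  0 < alpha < 1 -> 0 < c -> C1_positive x dx ->
  (forall s, 0 <= s <= c -> x s <= x c) ->
  (x c - x 0) * c `^ (- alpha) <= abel_integral alpha dx c.
Proof.
by move=> halpha c0 xC1 /(abel_extremum halpha (lexx 0) c0 xC1); rewrite subr0.
Qed.

Lemma abel_integralN (R : realType) (alpha : R) (dx : R -> R) (c : R) :
  0 < alpha < 1 -> 0 < c -> continuous dx ->
  abel_integral alpha (\- dx) c = - abel_integral alpha dx c.
Proof.
move=> /andP[a0 a1] c0 cdx; rewrite -mulN1r -RintegralZl//; last exact: integrable_abel.
by apply: eq_Rintegral => s _; rewrite mulN1r mulNr.
Qed.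

(** The right-hand side is the Abel integral of the constant [M]. *)
Lemma abel_integral_le (R : realType) (alpha : R) (dx : R -> R) (M c : R) :
  0 < alpha < 1 -> 0 < c -> continuous dx ->
  (forall s : R, 0 < s < c -> dx s <= M) ->
  abel_integral alpha dx c <= M * (1 - alpha)^-1 * c `^ (1 - alpha).
Proof.
move=> /[dup] halpha /andP[a0 a1] c0 cdx dxM.
have b0 : 0 < 1 - alpha by lra.
pose F s := - (M * (1 - alpha)^-1) * (c - s) `^ (1 - alpha).
have dF s : 0 < s < c -> is_derive s 1 F (M * (c - s) `^ (- alpha)).
  move=> /andP[_ sc].
  apply: is_derive_scaleE (is_derive_powRB (1 - alpha) sc) _.
  rewrite (_ : 1 - alpha - 1 = - alpha); last by ring.
  field; lra.
have cF : {within `[0, c], continuous F}.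
  apply: (@continuous_within_powR_bound _ _ (1 - alpha) _ _ `|M * (1 - alpha)^-1|) => //.
  - move=> s; rewrite in_itv/= => /andP[_ sc].
    by apply: cvgMr; exact: continuous_powRB.
  - by rewrite /F subrr powR0 ?gt_eqF// mulr0.
  - by move=> s _; rewrite normrM normrN (ger0_norm (powR_ge0 _ _)).
have ck : {in `]0, c[, continuous (fun s => dx s * (c - s) `^ (- alpha))}.
  move=> s; rewrite in_itv/= => /andP[_ sc]; apply: cvgM; first exact: cdx.
  exact: continuous_powRB.
have intk : lebesgue_measure.-integrable `[0, c]
    (EFin \o (fun s => dx s * (c - s) `^ (- alpha))) by exact: integrable_abel.
have := @Rintegral_le_antiderivative R _ _ _ 0 c c0 intk ck cF dF.
rewrite /F subrr powR0 ?gt_eqF// mulr0 subr0 sub0r mulNr opprK; apply.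
by move=> s sc; rewrite ler_wpM2r ?powR_ge0// dxM.
Qed.

Lemma abel_integral_bound (R : realType) (alpha : R) (dx : R -> R) (M c : R) :
  0 < alpha < 1 -> 0 < c -> continuous dx ->
  (forall s : R, 0 < s < c -> `|dx s| <= M) ->
  `|abel_integral alpha dx c| <= M * (1 - alpha)^-1 * c `^ (1 - alpha).
Proof.
move=> halpha c0 cdx dxM; rewrite ler_norml; apply/andP; split.
  rewrite lerNl -abel_integralN//; apply: abel_integral_le => //.
    by move=> s; apply: cvgN; exact: cdx.
  by move=> s /dxM; rewrite ler_norml => /andP[? _]; rewrite lerNl.
by apply: abel_integral_le => // s /dxM; rewrite ler_norml => /andP[].
Qed.

(** This is the monotonicity of the power 1 - beta. It replaces a ratio of fractional powers by the
    rational v / u, which polynomial arithmetic can handle. *)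
Lemma powRB_ratio (R : realType) (beta u v : R) : 0 < u -> u <= v -> beta <= 1 ->
  u `^ (- beta) <= v / u * v `^ (- beta).
Proof.
move=> u0 uv b1; have v0 := lt_le_trans u0 uv.
rewrite mulrAC ler_pdivlMr// -{2}(powRr1 (ltW u0)) -{1}(powRr1 (ltW v0)).
rewrite -!powRD_gt0// addrC.
by rewrite ge0_ler_powR ?nnegrE ?(ltW u0) ?(ltW v0)//; lra.
Qed.

(** * Positivity of Abel integrals far from the origin *)

(** Integration by parts with w = M: x - M is nonpositive and the kernel nondecreasing. On the head
    [0, T] the kernel has no singularity. *)
Lemma kernel_by_parts_head (R : realType) (x dx k dk : R -> R) (M T : R) :
  0 < T -> C1_positive x dx -> (forall s, 0 <= s <= T -> x s <= M) ->
  (forall s, 0 <= s <= T -> is_derive s 1 k (dk s)) ->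
  (forall s, 0 <= s <= T -> 0 <= dk s) ->
  (x T - M) * k T - (x 0 - M) * k 0 <=
  \int[lebesgue_measure]_(s in `[0, T]) (dx s * k s).
Proof.
move=> T0 xC1 xM kE dk0; have [cx cdx _] := xC1.
have ck : {within `[0, T], continuous k}.
  apply: continuous_in_subspaceT => s; rewrite inE/= in_itv/= => sT.
  exact: is_derive_continuous (kE _ sT).
apply: (@Rintegral_by_parts_ge R x dx k dk) => //.
- apply: integrable_itv_continuousM => //.
  apply: continuous_compact_integrable ck.
  exact: segment_compact.
- by move=> s /andP[s0 sT]; apply: kE; rewrite !ltW.
- apply: continuous_in_subspaceT => s; rewrite inE/= in_itv/= => sT.
  apply: cvgM; last exact: is_derive_continuous (kE _ sT).
  by apply: cvgB; [exact: cx|exact: cvg_cst].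
- move=> s /andP[s0 sT]; rewrite mulr_le0_ge0 ?subr_le0 ?xM ?dk0 ?(ltW s0) ?(ltW sT)//.
Qed.

(** The tail is nonnegative because [b] maximises [x] on [T, b]. The head is at least (M - x(0))
    k(0) - M k(T), and k(T) / k(0) is close to 1 when [b] is far beyond [T]; the last hypothesis
    says how far. The lemma serves for the opposite of a solution that starts positive. *)
Lemma abel_integral_gt0_at_zero (R : realType) (alpha : R) (x dx : R -> R) (M T b : R) :
  0 < alpha < 1 -> C1_positive x dx -> 0 < T -> T < b ->
  x T = 0 -> x b = 0 -> x 0 < 0 ->
  (forall s, 0 <= s <= T -> `|x s| <= M) -> (forall s, T <= s <= b -> x s <= 0) ->
  M * T < - x 0 * (b - T) -> 0 < abel_integral alpha dx b.
Proof.
move=> /[dup] halpha /andP[a0 a1] xC1 T0 Tb xT0 xb0 x00 xM xle MT.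
have [_ cdx _] := xC1.
have M0 : 0 <= M.
  by have := xM T; rewrite lexx (ltW T0) => /(_ isT); exact: le_trans.
rewrite (abel_integral_split halpha (ltW T0) Tb cdx).
have tail := abel_extremum halpha (ltW T0) Tb xC1.
rewrite xT0 xb0 subrr mul0r in tail.
rewrite ltr_pwDl//; last exact: tail.
pose k s := (b - s) `^ (- alpha).
have head := @kernel_by_parts_head R x dx k (fun s => alpha * (b - s) `^ (- alpha - 1)) M T T0 xC1.
apply: lt_le_trans (head _ _ _).
- rewrite xT0 /k subr0 sub0r.
  have := @powRB_ratio R alpha (b - T) b; move=> /(_ _ _ _)/wrap[]; try lra.
  set kT := (b - T) `^ _; set k0 := b `^ _ => kTk0.
  have k00 : 0 < k0 by rewrite powR_gt0; lra.
  have : M * kT <= M * (b / (b - T) * k0) by rewrite ler_wpM2l.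
  have : M * (b / (b - T)) - M < - x 0.
    rewrite -(@ltr_pM2r _ (b - T)) ?subr_gt0//.
    have -> : (M * (b / (b - T)) - M) * (b - T) = M * T by field; lra.
    done.
  rewrite -(ltr_pM2r k00); nra.
- by move=> s sT; have := xM _ sT; rewrite ler_norml => /andP[].
- by move=> s sT; apply: is_derive_kernel; lra.
- by move=> s sT; rewrite mulr_ge0 ?powR_ge0// ltW.
Qed.

(** The quotient (b - s) / (c - s) = 1 - (c - b) / (c - s) decreases in s, and a nonnegative power
    preserves the order. *)
Lemma powRB_quotient_noninc (R : realType) (p b c s t : R) :
  0 <= p -> b <= c -> s <= t -> t < b ->
  (b - t) `^ p * (c - t) `^ (- p) <= (b - s) `^ p * (c - s) `^ (- p).
Proof.
move=> p0 bc st tb.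
have h r : r < b -> (b - r) `^ p * (c - r) `^ (- p) = ((b - r) / (c - r)) `^ p.
  move=> rb; have br : 0 < b - r by lra.
  have cr : 0 < c - r by lra.
  rewrite powRM ?invr_ge0 ?(ltW br) ?(ltW cr)//; congr (_ * _).
  by rewrite -powR_inv1 ?(ltW cr)// -powRrM mulN1r.
have sb : s < b by lra.
rewrite !h//.
have ct : 0 < c - t by lra.
have cs : 0 < c - s by lra.
rewrite ge0_ler_powR ?nnegrE// ?divr_ge0//; try lra.
by rewrite ler_pdivrMr// mulrAC ler_pdivlMr//; nra.
Qed.

Lemma integrable_abelB (R : realType) (alpha : R) (y : R -> R) (lam a b c : R) :
  alpha < 1 -> a < b -> b < c -> continuous y ->
  lebesgue_measure.-integrable `[a, b]
    (EFin \o (fun s => y s * ((c - s) `^ (- alpha) - lam * (b - s) `^ (- alpha)))) /\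
  \int[lebesgue_measure]_(s in `[a, b])
    (y s * ((c - s) `^ (- alpha) - lam * (b - s) `^ (- alpha))) =
  \int[lebesgue_measure]_(s in `[a, b]) (y s * (c - s) `^ (- alpha)) -
  lam * \int[lebesgue_measure]_(s in `[a, b]) (y s * (b - s) `^ (- alpha)).
Proof.
move=> a1 ab bc cy.
have fE : (fun s => y s * ((c - s) `^ (- alpha) - lam * (b - s) `^ (- alpha))) =
  (fun s => y s * (c - s) `^ (- alpha) - lam * (y s * (b - s) `^ (- alpha))).
  by apply/funext => s; ring.
have i1 : lebesgue_measure.-integrable `[a, b]
    (EFin \o (fun s => y s * (c - s) `^ (- alpha))).
  by apply: integrable_abel => //; lra.
have i2 : lebesgue_measure.-integrable `[a, b]
    (EFin \o (fun s => y s * (b - s) `^ (- alpha))).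
  by apply: integrable_abel.
have i3 : lebesgue_measure.-integrable `[a, b]
    (EFin \o (fun s => lam * (y s * (b - s) `^ (- alpha)))).
  exact: integrable_scale.
rewrite fE; split; last by rewrite RintegralB// RintegralZl.
exact: (integrableB _ i1 i3).
Qed.

(** The part after [b] is nonnegative because [c] maximises [x] on [b, c]. The part before [b] is
    compared with the vanishing integral at [b], through the change of the relative weights of the
    past. *)
Lemma abel_integral_gt0_after_zero (R : realType) (alpha : R) (x dx : R -> R) (M T b c : R) :
  0 < alpha < 1 -> C1_positive x dx -> 0 < T -> T < b -> b < c ->
  x T = 0 -> x b = 0 -> x 0 < 0 -> 0 <= x c ->
  (forall s, 0 <= s <= T -> `|x s| <= M) -> (forall s, T <= s <= b -> 0 <= x s) ->
  (forall s, b <= s <= c -> x s <= x c) ->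
  2 * T <= b -> 3 * M * T < - x 0 * (b - T) -> abel_integral alpha dx b = 0 ->
  0 < abel_integral alpha dx c.
Proof.
move=> /[dup] halpha /andP[a0 a1] xC1 T0 Tb bc xT0 xb0 x00 xc0 xM xge xmax T2 MT Jb.
have [cx cdx _] := xC1.
have M0 : 0 <= M.
  by have := xM T; rewrite lexx (ltW T0) => /(_ isT); exact: le_trans.
have b0 : 0 < b by lra.
rewrite (abel_integral_split halpha (ltW b0) bc cdx).
have := abel_extremum halpha (ltW b0) bc xC1 xmax.
have : 0 <= (x c - x b) * (c - b) `^ (- alpha).
  by rewrite xb0 subr0 mulr_ge0// powR_ge0.
suff : 0 < \int[lebesgue_measure]_(s in `[0, b]) (dx s * (c - s) `^ (- alpha)) by lra.
(* rho s is the ratio of the weights at c and b. Subtracting lam times the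
   vanishing integral at b yields a kernel k that increases before T, where x
   is merely bounded, and decreases between T and b, where x is nonnegative. *)
pose rho s := (b - s) `^ (alpha + 1) * (c - s) `^ (- (alpha + 1)).
pose lam := rho T.
have rho_dec s t : s <= t -> t < b -> rho t <= rho s.
  by move=> st tb; apply: powRB_quotient_noninc => //; lra.
pose k s := (c - s) `^ (- alpha) - lam * (b - s) `^ (- alpha).
pose dk s := alpha * (c - s) `^ (- alpha - 1) - lam * (alpha * (b - s) `^ (- alpha - 1)).
have kE s : s < b -> is_derive s 1 k (dk s).
  move=> sb; have sc : s < c by lra.
  have h1 := is_derive_scaleE (k := - lam) (is_derive_kernel alpha sb) erefl.
  have := is_derive_addE (is_derive_kernel alpha sc) h1 erefl.
  rewrite mulNr; under eq_fun do rewrite mulNr.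
  by [].
(* Factoring out the weight at [b] reduces the sign of [dk] to the monotonicity of [rho]. *)
have dkE s : s < b -> dk s = alpha * (b - s) `^ (- alpha - 1) * (rho s - rho T).
  move=> sb; rewrite /dk -/lam /rho.
  have -> : - (alpha + 1) = - alpha - 1 by ring.
  have : (b - s) `^ (- alpha - 1) * (b - s) `^ (alpha + 1) = 1.
    rewrite -powRD_gt0 ?subr_gt0//.
    by rewrite (_ : - alpha - 1 + (alpha + 1) = 0) ?powRr0//; ring.
  set B := (b - s) `^ (- alpha - 1); set B' := (b - s) `^ _; set C := (c - s) `^ _.
  move=> BB.
  have -> : alpha * B * (B' * C - lam) = alpha * (B * B') * C - lam * (alpha * B) by ring.
  by rewrite BB mulr1.
(* At s = T the left side is [k T]; at s = 0 it is at most [k 0], since lam <= rho 0. Both boundary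
   values thus carry the factor c - b. *)
have kval s : s < b -> (c - s) `^ (- alpha) - rho s * (b - s) `^ (- alpha) =
    (c - b) * (c - s) `^ (- (alpha + 1)).
  move=> sb; rewrite /rho.
  have e1 : (c - s) `^ (- alpha) = (c - s) * (c - s) `^ (- (alpha + 1)).
    rewrite -{2}(powRr1 (a := c - s)); last lra.
    by rewrite -powRD_gt0; [congr (_ `^ _); ring|lra].
  have e2 : (b - s) `^ (alpha + 1) * (b - s) `^ (- alpha) = b - s.
    rewrite -powRD_gt0 ?subr_gt0//.
    rewrite (_ : alpha + 1 - alpha = 1); last by ring.
    by rewrite powRr1//; lra.
  rewrite e1; set C := (c - s) `^ _.
  by rewrite mulrAC e2; ring.
have intE := @integrable_abelB R alpha dx lam.
have -> : \int[lebesgue_measure]_(s in `[0, b]) (dx s * (c - s) `^ (- alpha)) =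
    \int[lebesgue_measure]_(s in `[0, b]) (dx s * k s).
  have [_ ->] := intE 0 b c a1 b0 bc cdx.
  by move: Jb; rewrite /abel_integral => ->; rewrite mulr0 subr0.
rewrite (@Rintegral_itv_split _ _ 0 T b) ?(ltW T0) ?(ltW Tb)//; last first.
  by have [] := intE 0 b c a1 b0 bc cdx.
have tail : 0 <= \int[lebesgue_measure]_(s in `[T, b]) (dx s * k s).
  have := @Rintegral_by_parts_ge R x dx k dk 0 T b (ltW T0) Tb xC1.
  rewrite xT0 xb0 !subr0 !mul0r subr0; apply.
  - by have [] := intE T b c a1 Tb bc cdx.
  - by move=> s /andP[_ sb]; exact: kE.
  (* Only the part of [k] singular at [b] needs x(b) = 0 for continuity; the part based at [c] is
     regular on [T, b]. *)
  - have c1 := kernel_primitive_continuous halpha (ltW T0) Tb xC1.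
    have c2 : {within `[T, b], continuous (fun s => (x s - x b) * (c - s) `^ (- alpha))}.
      apply: continuous_in_subspaceT => s; rewrite inE/= in_itv/= => sT.
      apply: cvgM; first by apply: cvgB; [exact: cx|exact: cvg_cst].
      by apply: continuous_powRB; lra.
    rewrite (_ : (fun s => _) = (fun s => (x s - x b) * (c - s) `^ (- alpha)) \-
      (fun s => lam * ((x s - x b) * (b - s) `^ (- alpha)))); last first.
      by apply/funext => s /=; rewrite xb0 /k; ring.
    move=> s; apply: cvgB; first exact: c2.
    by apply: cvgMr; exact: c1.
  - move=> s /andP[Ts sb]; rewrite subr0 mulr_ge0_le0 ?xge ?(ltW Ts) ?(ltW sb)//.
    rewrite dkE// mulr_ge0_le0// ?mulr_ge0 ?powR_ge0 ?(ltW a0)// subr_le0.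
    by apply: rho_dec => //; exact: ltW.
rewrite ltr_pwDl//.
apply: lt_le_trans (@kernel_by_parts_head R x dx k dk M T T0 xC1 _ _ _).
- rewrite xT0 sub0r; have -> : k T = (c - b) * (c - T) `^ (- (alpha + 1)) by exact: kval.
  have k0 : (c - b) * c `^ (- (alpha + 1)) <= k 0.
    have := kval 0 b0; rewrite !subr0 => <-.
    rewrite /k !subr0 lerD2l lerN2 ler_wpM2r ?powR_ge0//.
    by apply: rho_dec => //; exact: ltW.
  have cT : 0 < c - T by lra.
  have c0 : 0 < c by lra.
  (* The exponent alpha + 1 exceeds 1, so [powRB_ratio] is applied to alpha and the remaining factor
     1 / (c - T) gives the square. *)
  have rT : (c - T) `^ (- (alpha + 1)) <= (c / (c - T)) ^+ 2 * c `^ (- (alpha + 1)).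
    have := @powRB_ratio R alpha (c - T) c cT _ (ltW a1).
    have -> : (c - T) `^ (- (alpha + 1)) = (c - T) `^ (- alpha) / (c - T).
      by rewrite opprD powRD_gt0// powR_inv1 ?(ltW cT).
    have -> : c `^ (- (alpha + 1)) = c `^ (- alpha) / c.
      by rewrite opprD powRD_gt0// powR_inv1 ?(ltW c0).
    move=> /(_ _)/wrap[]; first lra.
    rewrite -(ler_pM2r (x := (c - T)^-1)) ?invr_gt0// => h; apply: le_trans h _.
    rewrite le_eqVlt; apply/orP; left; apply/eqP; field; lra.
  move: rT; set KT := (c - T) `^ _; set K0 := c `^ _ => rT.
  have K00 : 0 < K0 by rewrite powR_gt0.
  have h1 : M * (c / (c - T)) ^+ 2 - M < - x 0.
    rewrite -(@ltr_pM2r _ ((c - T) ^+ 2)) ?exprn_gt0//.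
    have -> : (M * (c / (c - T)) ^+ 2 - M) * (c - T) ^+ 2 = M * T * (2 * c - T) by field; lra.
    (* 2c - T <= 3(c - T) amounts to 2T <= c, which holds as 2T <= b < c. This is where the factor 3
       in the hypothesis comes from. *)
    have h2 : M * T * (2 * c - T) <= M * T * (3 * (c - T)).
      by rewrite ler_wpM2l ?mulr_ge0 ?(ltW T0)//; lra.
    apply: le_lt_trans h2 _.
    have : 3 * M * T < - x 0 * (c - T) by nra.
    rewrite -(ltr_pM2r cT); nra.
  have h3 : M * KT <= M * ((c / (c - T)) ^+ 2 * K0) by rewrite ler_wpM2l.
  have cb : 0 < c - b by lra.
  have h4 : M * KT < (M - x 0) * K0 by nra.
  have h5 : (M - x 0) * ((c - b) * K0) <= (M - x 0) * k 0 by rewrite ler_wpM2l//; lra.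
  nra.
- by move=> s sT; have := xM _ sT; rewrite ler_norml => /andP[].
- by move=> s sT; apply: kE; lra.
- move=> s /andP[s0 sT]; rewrite dkE; last lra.
  rewrite mulr_ge0 ?mulr_ge0 ?powR_ge0 ?(ltW a0)// subr_ge0.
  by apply: rho_dec.
Qed.

(** * The fractional system *)

(* G stands for 1 / Gamma(1 - alpha); only the values at nonnegative times matter. *)
Definition caputo_system (R : realType) (alpha G : R) (q x dx u : R -> R) :=
  [/\ C1_positive x dx, continuous q,
      forall t : R, 0 < t -> u t = G * abel_integral alpha dx t &
      forall t : R, 0 < t -> is_derive t 1 u (- (q t * x t))].

Lemma caputo_systemN (R : realType) (alpha G : R) (q x dx u : R -> R) :
  0 < alpha < 1 ->
  caputo_system alpha G q x dx u -> caputo_system alpha G q (\- x) (\- dx) (\- u).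
Proof.
move=> halpha [xC1 cq uE duE]; split => //.
- exact: C1_positiveN.
- move=> t t0; have [_ cdx _] := xC1.
  by rewrite abel_integralN// mulrN /= uE.
- move=> t t0; have -> : - (q t * - x t) = - - (q t * x t) by ring.
  exact: is_deriveN (duE t t0).
Qed.

(** * Uniqueness from the initial value zero *)

(** [B - v] is nondecreasing on [e, c], hence v(c) - B(c) <= v(e) - B(e) <= K e^beta, and e tends to
    0. The power bound stands in for an initial value of [v], which is known only at positive
    times. *)
Lemma le_at_right_bound (R : realType) (v dv B dB : R -> R) (K beta c : R) :
  0 < c -> 0 < beta ->
  (forall s : R, 0 < s -> is_derive s 1 v (dv s)) ->
  (forall s : R, 0 < s -> is_derive s 1 B (dB s)) ->
  (forall s : R, 0 < s < c -> dv s <= dB s) ->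
  (forall s : R, 0 < s < c -> v s <= K * s `^ beta) ->
  (forall s : R, 0 <= B s) -> v c <= B c.
Proof.
move=> c0 beta0 vE BE dvB vK B0.
have h (e : R) : 0 < e < c -> v c - B c <= K * e `^ beta.
  move=> /andP[e0 ec].
  pose g (s : R) := B s - v s.
  have gE (s : R) : 0 < s -> is_derive s 1 g (dB s - dv s).
    by move=> s0; apply: is_deriveB; [exact: BE|exact: vE].
  have : g e <= g c.
    apply: (@ger0_derive1_ndecr R g e c) => //; try exact: ltW.
    - by move=> s; rewrite in_itv/= => /andP[es _]; have [] := gE s (lt_trans e0 es).
    - move=> s; rewrite in_itv/= => /andP[es sc]; have s0 := lt_trans e0 es.
      rewrite derive1E; have [_ ->] := gE s s0.
      by rewrite subr_ge0 dvB// s0.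
    - apply: continuous_in_subspaceT => s; rewrite inE/= in_itv/= => /andP[es _].
      exact: is_derive_continuous (gE s (lt_le_trans e0 es)).
  have ec' : 0 < e < c by rewrite e0.
  by have := vK e ec'; have := B0 e; rewrite /g; lra.
have cvg0 : K * e `^ beta @[e --> 0^'+] --> (0 : R).
  by have := cvgMr (a := K) (powR_cvg0 beta0); rewrite mulr0; apply.
suff : v c - B c <= 0 by lra.
rewrite -(cvg_lim _ cvg0)//; apply: limr_ge.
  by apply/cvg_ex; exists 0.
near=> e; apply: h; apply/andP; split; near: e.
- exact: nbhs_right_gt.
- exact: nbhs_right_lt.
Unshelve. all: by end_near. Qed.

(** Two estimates of |u(c)| collide: at least |G| x(c) N^(-alpha) by [abel_ge_max], at most Q x(c) /
    lam by integrating u' = - q x. *)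
Lemma caputo_weighted_max_false (R : realType) (alpha G : R) (q x dx u : R -> R)
    (Q N lam c : R) :
  0 < alpha < 1 -> caputo_system alpha G q x dx u -> x 0 = 0 ->
  (forall s : R, 0 <= s <= N -> `|q s| <= Q) -> 0 < c <= N -> 0 < x c -> 0 < lam ->
  (forall s : R, 0 <= s <= c -> `|x s| <= x c * expR (lam * (s - c))) ->
  Q < lam * `|G| * N `^ (- alpha) -> False.
Proof.
move=> /[dup] halpha /andP[a0 a1] [xC1 cq uE duE] x0 qQ /andP[c0 cN] xc0 lam0 xmax QG.
have [_ cdx _] := xC1.
have N0 : 0 < N by lra.
have Q0 : 0 <= Q.
  by have := qQ N; rewrite lexx (ltW N0) => /(_ isT); exact: le_trans.
(* The exponential is at most 1 before [c], so [c] is an ordinary maximum of [x] on [0, c]. Passing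
   from c^(-alpha) to N^(-alpha) makes the threshold for [lam] independent of [c], which itself
   depends on [lam]. *)
have Jc : x c * N `^ (- alpha) <= abel_integral alpha dx c.
  have := abel_ge_max halpha c0 xC1; rewrite x0 subr0 => /(_ _)/wrap[].
    move=> s sc; apply: (le_trans (ler_norm _)); apply: (le_trans (xmax s sc)).
    rewrite ler_piMr ?(ltW xc0)// -expR0 ler_expR.
    by rewrite mulr_ge0_le0 ?(ltW lam0)//; lra.
  apply: le_trans; rewrite ler_pM2l// !powRN lef_pV2 ?posrE ?powR_gt0//.
  by rewrite ge0_ler_powR ?nnegrE ?(ltW a0) ?(ltW c0) ?(ltW N0).
have [M M0 dxM] := continuous_itv_bounded (ltW c0) cdx.
pose K := `|G| * (M * (1 - alpha)^-1).
have uK (s : R) : 0 < s < c -> `|u s| <= K * s `^ (1 - alpha).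
  move=> /andP[s0 sc]; rewrite uE// normrM /K -mulrA ler_wpM2l//.
  by apply: abel_integral_bound => // r r0; apply: dxM; lra.
(* The primitive of the bound on |u'| that tends to 0 at minus infinity: it is nonnegative and
   equals Q x(c) / lam at [c]. *)
pose B (s : R) := Q * x c / lam * expR (lam * (s - c)).
have BE (s : R) : is_derive s (1 : R) B (Q * x c * expR (lam * (s - c))).
  have h1 : is_derive s (1 : R) (fun s => s - c) 1.
    by apply: is_derive_addE (is_derive_id s 1) (is_derive_cst (- c) s 1) _; rewrite addr0.
  have h2 := is_derive_scaleE (k := lam) h1 erefl.
  have h3 := @is_derive1_comp R expR (fun s => lam * (s - c)) s _ _ (is_derive_expR _) h2.
  apply: is_derive_scaleE h3 _; field; lra.
have B0 (s : R) : 0 <= B s.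
  by rewrite /B mulr_ge0 ?expR_ge0 ?divr_ge0 ?mulr_ge0 ?(ltW xc0) ?(ltW lam0).
have duB (s : R) : 0 < s < c -> `|q s * x s| <= Q * x c * expR (lam * (s - c)).
  move=> /andP[s0 sc]; rewrite normrM -mulrA ler_pM//.
    by apply: qQ; lra.
  by apply: xmax; lra.
have b0 : 0 < 1 - alpha by lra.
have u1 : u c <= B c.
  apply: (@le_at_right_bound R u _ B _ K (1 - alpha) c c0 b0 duE (fun s _ => BE s)) => //.
    by move=> s /duB; rewrite ler_norml; lra.
  by move=> s /uK; rewrite ler_norml => /andP[].
have u2 : - u c <= B c.
  apply: (@le_at_right_bound R (\- u) (fun s => q s * x s) B _ K (1 - alpha) c c0 b0 _
    (fun s _ => BE s)) => //.
  - by move=> s s0; rewrite -[q s * x s]opprK; apply: is_deriveN (duE s s0).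
  - by move=> s /duB; rewrite ler_norml; lra.
  - by move=> s /uK; rewrite ler_norml /= => /andP[]; lra.
have : `|u c| <= Q * x c / lam.
  by rewrite ler_norml; move: u1 u2; rewrite /B subrr mulr0 expR0 mulr1; lra.
apply/negP; rewrite -ltNge ltr_pdivrMr// uE// normrM.
have : `|G| * (x c * N `^ (- alpha)) <= `|G| * `|abel_integral alpha dx c|.
  by rewrite ler_wpM2l// (le_trans Jc)// ler_norm.
move=> h; have : Q * x c < lam * `|G| * N `^ (- alpha) * x c by rewrite ltr_pM2r.
rewrite -(ler_pM2r lam0) in h; move: h; lra.
Qed.

Lemma caputo_system_unique (R : realType) (alpha G : R) (q x dx u : R -> R) :
  0 < alpha < 1 -> G != 0 -> caputo_system alpha G q x dx u -> x 0 = 0 ->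
  forall t : R, 0 <= t -> x t = 0.
Proof.
move=> halpha G0 sys x0 N N0; apply/eqP/negPn/negP => xN.
have {}N0 : 0 < N.
  by rewrite lt_neqAle N0 andbT; apply: contraNneq xN => <-; rewrite x0.
have [[cx cdx _] cq _ _] := sys.
have [Q Q0 qQ] := continuous_itv_bounded (ltW N0) cq.
have GN : 0 < `|G| * N `^ (- alpha) by rewrite mulr_gt0 ?normr_gt0 ?powR_gt0.
(* Chosen so that lam |G| N^(-alpha) = Q + 1. *)
pose lam := (Q + 1) / (`|G| * N `^ (- alpha)).
have lam0 : 0 < lam by rewrite divr_gt0//; lra.
have lamQ : Q < lam * `|G| * N `^ (- alpha).
  by rewrite -mulrA /lam divfK ?gt_eqF//; lra.
have [|c] := @EVT_max R (fun s => `|x s| * expR (- (lam * s))) 0 N (ltW N0).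
  apply: continuous_subspaceT => s; apply: cvgM.
    by apply: cvg_norm; exact: cx.
  have := @continuous_comp R R R (fun s => - (lam * s)) expR s; apply.
    by apply: cvgN; apply: cvgMr; exact: cvg_id.
  exact: continuous_expR.
rewrite in_itv/= => /andP[c0 cN] cmax.
have xc : 0 < `|x c|.
  have := cmax N; rewrite in_itv/= lexx (ltW N0) => /(_ isT) h.
  rewrite -(pmulr_lgt0 _ (expR_gt0 (- (lam * c)))); apply: lt_le_trans h.
  by rewrite mulr_gt0 ?normr_gt0 ?expR_gt0.
have {}c0 : 0 < c.
  rewrite lt_neqAle c0 andbT; apply: contraTneq xc => <-.
  by rewrite x0 normr0 ltxx.
have {}cmax (s : R) : 0 <= s <= c -> `|x s| <= `|x c| * expR (lam * (s - c)).
  move=> sc; have := cmax s; rewrite in_itv/= => /(_ _)/wrap[]; first by lra.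
  rewrite -(ler_pM2r (expR_gt0 (lam * s))) -!mulrA -!expRD.
  rewrite addNr expR0 mulr1; congr (_ <= _ * expR _); ring.
have c0N : 0 < c <= N by rewrite c0.
have [xc0|xc0] := ltP 0 (x c).
  rewrite gtr0_norm// in cmax.
  exact: (caputo_weighted_max_false halpha sys x0 qQ c0N xc0 lam0 cmax lamQ).
have {}xc0 : 0 < (\- x) c.
  by rewrite /= oppr_gt0 lt_neqAle xc0 -normr_gt0 xc.
apply: (caputo_weighted_max_false halpha (caputo_systemN halpha sys) _ qQ c0N xc0 lam0 _ lamQ).
- by rewrite /= x0 oppr0.
- by move=> s sc; rewrite /= normrN (le_trans (cmax s sc))// -normrN gtr0_norm.
Qed.

(** * Exclusion of arbitrarily large zeros *)

(** When x'(c) = 0 the product is - u(c)^2, so its nonnegativity forces u(c) = 0. *)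
Lemma caputo_system_crit (R : realType) (alpha G : R) (q x dx u : R -> R) (c : R) :
  G != 0 -> caputo_system alpha G q x dx u -> 0 < c ->
  dx c = 0 -> 0 <= u c * (dx c - u c) -> abel_integral alpha dx c = 0.
Proof.
move=> G0 [_ _ uE _] c0 -> h.
have /eqP : u c = 0.
  by apply/eqP; rewrite -sqrf_eq0 eq_le sqr_ge0 andbT expr2; lra.
by rewrite uE// mulf_eq0 (negbTE G0) => /eqP.
Qed.

Lemma C1_positive_zero (R : realType) (x dx : R -> R) (T c : R) :
  C1_positive x dx -> 0 <= T -> T < c -> (forall s : R, T <= s -> 0 <= x s) ->
  x c = 0 -> dx c = 0.
Proof.
move=> [_ _ xE] T0 Tc xge xc.
have : is_derive c 1 x 0.
  apply: (@derive1_at_min R x T (c + 1)); first lra.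
  - by move=> t; rewrite in_itv/= => /andP[Tt _]; have [] := xE t (le_lt_trans T0 Tt).
  - by rewrite in_itv/=; lra.
  - by move=> t; rewrite in_itv/= => /andP[Tt _]; rewrite xc xge// ltW.
by move=> [_ <-]; have [_ ->] := xE c (le_lt_trans T0 Tc).
Qed.

(** Otherwise there are zeros T < b < b' with [b] as large as desired. If x(0) > 0, the vanishing
    integral at [b] is already absurd; if x(0) < 0, a maximum point of [x] on [b, b'] provides the
    later point required by [abel_integral_gt0_after_zero]. *)
Lemma caputo_system_large_zeros (R : realType) (alpha G : R) (q x dx u : R -> R) (T0 : R) :
  0 < alpha < 1 -> G != 0 -> caputo_system alpha G q x dx u -> 0 < T0 -> x 0 != 0 ->
  (forall s : R, T0 <= s -> 0 <= x s) ->
  (forall s : R, T0 <= s -> 0 <= u s * (dx s - u s)) ->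
  exists A : R, T0 <= A /\ forall b : R, A < b -> x b != 0.
Proof.
move=> halpha G0 sys T00 x00 xge prod; apply: contrapT => nA.
have zeros (A : R) : T0 <= A -> exists b : R, A < b /\ x b = 0.
  move=> TA; apply: contrapT => nb; apply: nA; exists A; split => // b Ab.
  by apply/negP => /eqP xb; apply: nb; exists b.
have [xC1 _ uE duE] := sys; have [cx cdx xE] := xC1.
have [T [TT0 xT]] := zeros _ (lexx T0).
have Tpos : 0 < T by lra.
have crit (c : R) : T0 < c -> dx c = 0 -> abel_integral alpha dx c = 0.
  move=> Tc dxc; apply: (caputo_system_crit G0 sys _ dxc); first lra.
  by apply: prod; exact: ltW.
have zero (b : R) : T0 < b -> x b = 0 -> abel_integral alpha dx b = 0.
  move=> Tb xb; apply: crit => //.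
  exact: (C1_positive_zero xC1 (ltW T00) Tb xge xb).
have [M M0 xM] := continuous_itv_bounded (ltW Tpos) cx.
have X0 : 0 < `|x 0| by rewrite normr_gt0.
(* Every b > A satisfies both 2T <= b and 3MT < |x(0)| (b - T). *)
pose A := 2 * T + 3 * M * T / `|x 0|.
have A2T : 2 * T <= A by rewrite /A lerDl divr_ge0 ?mulr_ge0 ?(ltW Tpos) ?(ltW X0).
have AT : T0 <= A by lra.
have [b [Ab xb]] := zeros _ AT.
have Tb : T < b by lra.
have Tb0 : T0 < b by lra.
have bM : 3 * M * T < `|x 0| * (b - T).
  rewrite (mulrC `|x 0|) -ltr_pdivrMr//; move: Ab; rewrite /A; lra.
have Jb := zero b Tb0 xb.
have [x0pos|] := ltP 0 (x 0).
  rewrite gtr0_norm// in bM.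
  have : 0 < abel_integral alpha (\- dx) b.
    apply: (@abel_integral_gt0_at_zero R alpha (\- x) (\- dx) M T b) => //=.
    - exact: C1_positiveN.
    - by rewrite xT oppr0.
    - by rewrite xb oppr0.
    - by rewrite oppr_lt0.
    - by move=> s sT; rewrite normrN xM.
    - by move=> s /andP[Ts _]; rewrite oppr_le0 xge//; lra.
    - have : 0 <= M * T by rewrite mulr_ge0// ltW.
      rewrite opprK; lra.
  by rewrite abel_integralN// ?Jb ?oppr0 ?ltxx//; lra.
rewrite le_eqVlt (negbTE x00)/= => x0neg.
rewrite ltr0_norm// in bM.
have [|b' [bb' xb']] := zeros b; first lra.
have [|c] := @EVT_max R x b b' (ltW bb'); first exact: continuous_subspaceT.
rewrite in_itv/= => /andP[bc cb'] cmax.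
have {}cmax (s : R) : b <= s <= b' -> x s <= x c.
  by move=> sb; apply: cmax; rewrite in_itv.
have J0 (d : R) : b < d -> d <= b' -> 0 <= x d -> (forall s : R, b <= s <= d -> x s <= x d) ->
    abel_integral alpha dx d = 0 -> False.
  move=> bd db' xd0 dmax Jd.
  have bx (s : R) : T <= s <= b -> 0 <= x s.
    by move=> /andP[Ts _]; apply: xge; exact: le_trans (ltW TT0) Ts.
  have := @abel_integral_gt0_after_zero R alpha x dx M T b d halpha xC1 Tpos Tb bd
    xT xb x0neg xd0 xM bx dmax (le_trans A2T (ltW Ab)) bM Jb.
  by rewrite Jd ltxx.
(* If the maximum is not positive, the zero [b'] is itself a maximum point on [b, b']. If it is
   positive, it is attained in the interior and x' vanishes there. *)
have [xc0|xc0] := ltP 0 (x c); last first.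
  have b'0 : 0 <= x b' by rewrite xb'.
  have b'max (s : R) : b <= s <= b' -> x s <= x b'.
    by move=> sb; rewrite xb' (le_trans (cmax s sb)).
  exact: (J0 b' bb' (lexx b') b'0 b'max (zero b' (lt_trans Tb0 bb') xb')).
have {}bc : b < c.
  by rewrite lt_neqAle bc andbT; apply: contraTneq xc0 => <-; rewrite xb ltxx.
have {}cb' : c < b'.
  by rewrite lt_neqAle cb' andbT; apply: contraTneq xc0 => ->; rewrite xb' ltxx.
have bpos : 0 < b by exact: lt_trans T00 Tb0.
have : is_derive c 1 x 0.
  apply: (@derive1_at_max R x b b' c (ltW bb')).
  - by move=> t; rewrite in_itv/= => /andP[bt _]; have [] := xE t (lt_trans bpos bt).
  - by rewrite in_itv/= bc.
  - by move=> t; rewrite in_itv/= => /andP[bt tb]; apply: cmax; rewrite !ltW.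
move=> [_ dxc].
have {}dxc : dx c = 0 by rewrite -dxc; have [_ ->] := xE c (lt_trans bpos bc).
have dmax (s : R) : b <= s <= c -> x s <= x c.
  by move=> /andP[bs sc]; apply: cmax; rewrite bs (le_trans sc (ltW cb')).
exact: (J0 c bc (ltW cb') (ltW xc0) dmax (crit c (lt_trans Tb0 bc) dxc)).
Qed.

(** * The Riccati estimate *)

(** The bound is [F T] for the [F] below: both of its exponents are positive, so [F t = 0], and the
    derivative of - F dominates (t - s)^eps q(s). *)
Lemma riccati_bound (R : realType) (q x dx u : R -> R) (eps T t : R) :
  2 < eps -> 0 < T -> T < t -> continuous q ->
  (forall s : R, 0 < s -> is_derive s 1 x (dx s)) ->
  (forall s : R, 0 < s -> is_derive s 1 u (- (q s * x s))) ->
  (forall s : R, T <= s -> 0 < x s) ->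
  (forall s : R, T <= s -> 0 <= u s * (dx s - u s)) ->
  \int[lebesgue_measure]_(s in `[T, t]) ((t - s) `^ eps * q s) <=
  (t - T) `^ eps * (u T / x T) + eps ^+ 2 / 4 / (eps - 1) * (t - T) `^ (eps - 1).
Proof.
move=> e2 T0 Tt cq xE uE xpos prod.
have tE (p : R) : 0 < p -> {within `[T, t], continuous (fun s : R => (t - s) `^ p)}.
  exact: continuous_within_powRB.
have xne (s : R) : T <= s -> x s != 0 by move=> /xpos; rewrite lt0r => /andP[].
pose w (s : R) := u s * (x s)^-1.
have wE (s : R) : T <= s -> is_derive s 1 w (- q s - u s * dx s / (x s) ^+ 2).
  move=> Ts; have s0 : 0 < s by lra.
  apply: is_derive_mulE (uE s s0) (is_deriveV (xne s Ts) (xE s s0)) _.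
  rewrite /GRing.scale/=; field; exact: xne.
(* Completing the square in w costs (eps^2 / 4) (t - s)^(eps - 2), whose
   primitive is the second term of F, up to sign. *)
pose F (s : R) := (t - s) `^ eps * w s + eps ^+ 2 / 4 / (eps - 1) * (t - s) `^ (eps - 1).
pose dF (s : R) := - (eps * (t - s) `^ (eps - 1)) * w s +
  (t - s) `^ eps * (- q s - u s * dx s / (x s) ^+ 2) -
  eps ^+ 2 / 4 * (t - s) `^ (eps - 2).
have FE (s : R) : T < s < t -> is_derive s 1 F (dF s).
  move=> /andP[Ts st].
  apply: is_derive_addE (is_derive_mulE (is_derive_powRB eps st) (wE s (ltW Ts)) erefl)
    (is_derive_scaleE (is_derive_powRB (eps - 1) st) erefl) _.
  rewrite /dF (_ : eps - 1 - 1 = eps - 2); last by ring.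
  by congr (_ + _); field; lra.
have cF : {within `[T, t], continuous F}.
  have cw : {within `[T, t], continuous w}.
    apply: continuous_in_subspaceT => s; rewrite inE/= in_itv/= => /andP[Ts _].
    exact: is_derive_continuous (wE s Ts).
  move=> s; apply: cvgD; last by apply: cvgMr; apply: tE; lra.
  by apply: cvgM; [apply: tE; lra|exact: cw].
have cf : {in `]T, t[, continuous (fun s : R => (t - s) `^ eps * q s)}.
  move=> s; rewrite in_itv/= => /andP[_ st].
  by apply: cvgM; [exact: continuous_powRB|exact: cq].
have intf : lebesgue_measure.-integrable `[T, t]
    (EFin \o (fun s : R => (t - s) `^ eps * q s)).
  by apply: integrable_powRB_continuousM => //; lra.
have := @Rintegral_le_antiderivative R _ (fun s => - 1 * F s) (fun s => - 1 * dF s) T t Tt intf cf.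
have -> : - 1 * F t - - 1 * F T = F T.
  by rewrite /F subrr !powR0 ?mul0r ?mulr0 ?addr0 ?gt_eqF//; lra.
apply.
- by move=> s; apply: cvgMr; exact: cF.
- by move=> s /FE h; apply: is_derive_scaleE h _.
move=> s /andP[Ts st]; rewrite /dF.
have ts : 0 < t - s by lra.
(* With every power written through P = (t - s)^(eps - 2), the remainder becomes P times a completed
   square plus P (t - s)^2 times the defect in w^2 <= u x' / x^2. *)
have e1 : (t - s) `^ (eps - 1) = (t - s) * (t - s) `^ (eps - 2).
  by rewrite -{2}(powRr1 (ltW ts)) -powRD_gt0//; congr (_ `^ _); ring.
have e0 : (t - s) `^ eps = (t - s) ^+ 2 * (t - s) `^ (eps - 2).
  by rewrite -powR_mulrn ?(ltW ts)// -powRD_gt0//; congr (_ `^ _); ring.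
rewrite e1 e0; set P := (t - s) `^ _.
have P0 : 0 <= P by exact: powR_ge0.
have xs : 0 < x s by apply: xpos; exact: ltW.
have ww : (w s) ^+ 2 <= u s * dx s / (x s) ^+ 2.
  rewrite /w exprMn exprVn ler_pM2r ?invr_gt0 ?exprn_gt0//.
  by have := prod s (ltW Ts); nra.
set z := u s * dx s / _ in ww *.
have h : 0 <= P * ((t - s) * w s + eps / 2) ^+ 2 by rewrite mulr_ge0 ?sqr_ge0.
have h2 : 0 <= P * (t - s) ^+ 2 * (z - (w s) ^+ 2).
  by rewrite mulr_ge0 ?subr_ge0// mulr_ge0// sqr_ge0.
rewrite -subr_ge0.
rewrite [leRHS](_ : _ = P * ((t - s) * w s + eps / 2) ^+ 2 + P * (t - s) ^+ 2 * (z - (w s) ^+ 2)).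
  exact: addr_ge0.
by field.
Qed.

(** * Conclusion *)

(** An infinite integral would be read as 0, so finiteness matters as much as positivity. The
    integrand is compared with s^(z - 1) on ]0, 1[ and with e^(-s) beyond 1; positivity already
    comes from [1, 2]. *)
Lemma Gamma_neq0 (R : realType) (z : R) : 0 < z < 1 -> Gamma z != 0 :> R.
Proof.
move=> /andP[z0 z1].
pose D : set R := `]0, +oo[%classic.
pose f (s : R) := s `^ (z - 1) * expR (- s).
have f0 (s : R) : 0 <= f s by rewrite mulr_ge0 ?powR_ge0 ?expR_ge0.
have cexp : continuous (fun s : R => expR (- s)).
  move=> s; have := @continuous_comp R R R (fun s => - s) expR s; apply.
    by apply: cvgN; exact: cvg_id.
  exact: continuous_expR.
have cpow (s : R) : 0 < s -> {for s, continuous (fun s : R => s `^ (z - 1))}.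
  by move=> s0; exact: is_derive_continuous (is_derive1_powR _ s0).
have cf (s : R) : 0 < s -> {for s, continuous f}.
  by move=> s0; apply: cvgM; [exact: cpow|exact: cexp].
have mf : measurable_fun D f.
  apply: open_continuous_measurable_fun; first exact: interval_open.
  by move=> s; rewrite inE /D /= in_itv/= andbT; exact: cf.
have mD : measurable D by exact: measurable_itv.
have mfS (A : set R) : measurable A -> A `<=` D -> measurable_fun A (EFin \o f).
  by move=> mA A0; apply/measurable_EFinP; exact: measurable_funS mf.
have D01 : `]0, 1[%classic `<=` D by move=> s; rewrite /D /= !in_itv/= => /andP[->].
have D1 : `[1, +oo[%classic `<=` D.
  by move=> s; rewrite /D /= !in_itv/= !andbT; exact: lt_le_trans.
have h1 : (\int[lebesgue_measure]_(s in `]0%R, 1%R[) (f s)%:E < +oo)%E.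
  have intp : lebesgue_measure.-integrable `]0, 1[ (EFin \o (fun s : R => s `^ (z - 1))).
    apply: (@integrable_ge0_antiderivative R _ (fun s => z^-1 * s `^ z) 0 1) => //.
    - by move=> s; rewrite in_itv/= => /andP[s0 _]; exact: cpow.
    - apply/continuous_within_itvP => //; split.
      + move=> s; rewrite in_itv/= => /andP[s0 _]; apply: cvgMr.
        exact: is_derive_continuous (is_derive1_powR _ s0).
      + by rewrite powR0 ?gt_eqF//; apply: cvgMr; exact: powR_cvg0.
      + apply: cvgMr; apply: cvg_at_left_filter.
        exact: is_derive_continuous (is_derive1_powR _ ltr01).
    - move=> s /andP[s0 _]; apply: is_derive_scaleE (is_derive1_powR _ s0) _.
      by rewrite mulrA mulVf ?mul1r ?gt_eqF.
    - by move=> s _; exact: powR_ge0.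
  have /integrableP[_] : lebesgue_measure.-integrable `]0, 1[ (EFin \o f).
    apply: le_integrable intp => //; first exact: mfS.
    move=> s /=; rewrite in_itv/= => /andP[s0 _]; rewrite lee_fin.
    rewrite !ger0_norm ?powR_ge0// ler_piMr ?powR_ge0//.
    by rewrite -expR0 ler_expR; lra.
  by under eq_integral do rewrite /= ger0_norm//.
have dexp (s : R) : is_derive s (1 : R) (fun s : R => - expR (- s)) (expR (- s)).
  have h1' : is_derive s (1 : R) (fun s : R => - s) (- 1) by exact: is_deriveN (is_derive_id s 1).
  have := @is_derive1_comp R expR (fun s => - s) s _ _ (is_derive_expR _) h1'.
  by move=> /is_deriveN; rewrite mulrN1 opprK.
have h2 : (\int[lebesgue_measure]_(s in `[(1%R : R), +oo[) (expR (- s))%:E < +oo)%E.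
  rewrite (@ge0_continuous_FTC2y R (fun s => expR (- s)) (fun s => - expR (- s)) 1 0).
  - exact: ltry.
  - by move=> s _; exact: expR_ge0.
  - exact: continuous_subspaceT.
  - by rewrite -oppr0; apply: cvgN; exact: cvgr_expR.
  - by move=> s _; have [] := dexp s.
  - by apply: cvg_at_right_filter; apply: cvgN; exact: cexp.
  - by move=> s _; rewrite derive1E; have [_ ->] := dexp s.
have h3 : (\int[lebesgue_measure]_(s in `[1%R, +oo[) (f s)%:E < +oo)%E.
  apply: le_lt_trans h2; apply: ge0_le_integral => //.
  - by move=> s _; rewrite lee_fin.
  - exact: mfS.
  - by apply/measurable_EFinP; apply: measurable_funS (continuous_measurable_fun cexp).
  - move=> s /=; rewrite in_itv/= andbT lee_fin => s1.
    rewrite /f ler_piMl ?expR_ge0//; apply: (@le_trans _ _ (s `^ 0)); last by rewrite powRr0.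
    by apply: ler_powR => //; rewrite subr_le0 ltW.
have DE : D = `]0, 1[%classic `|` `[1, +oo[%classic.
  by rewrite /D -itv_bndbnd_setU ?bnd_simp.
have fin : (\int[lebesgue_measure]_(s in D) (f s)%:E < +oo)%E.
  rewrite DE ge0_integral_setU//.
  - exact: lte_add_pinfty.
  - by rewrite -DE; exact: mfS.
  - by move=> s _; rewrite lee_fin.
  - apply/disj_setPS => s [/=]; rewrite !in_itv/= andbT => /andP[_ ?]; lra.
have D12 : `[1, 2]%classic `<=` D.
  by move=> s; rewrite /D /= !in_itv/= andbT => /andP[? _]; lra.
(* [m] is f(2), a lower bound on [1, 2] because both factors decrease. *)
pose m : R := 2 `^ (z - 1) * expR (- 2).
have m0 : 0 < m by rewrite mulr_gt0 ?powR_gt0 ?expR_gt0.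
have hm : 0 < \int[lebesgue_measure]_(s in `[1, 2]) f s.
  have cf12 : {within `[1, 2], continuous f}.
    apply: continuous_in_subspaceT => s; rewrite inE/= in_itv/= => /andP[s1 _].
    by apply: cf; lra.
  have := @Rintegral_ge_antiderivative R f (fun s => m * s) (fun=> m) 1 2.
  rewrite -mulrBr => h; apply: (@lt_le_trans _ _ (m * (2 - 1))).
    by rewrite mulr_gt0//; lra.
  apply: h => //.
  - lra.
  - exact: continuous_compact_integrable (@segment_compact _ _ _) cf12.
  - by move=> s; rewrite in_itv/= => /andP[s1 _]; apply: cf; lra.
  - by apply: continuous_subspaceT => s; apply: cvgMr; exact: cvg_id.
  - by move=> s _; apply: is_derive_scaleE (is_derive_id s 1) _; rewrite mulr1.
  - move=> s /andP[s1 s2]; rewrite /m /f ler_pM ?powR_ge0 ?expR_ge0//.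
      rewrite -(opprB 1 z) !powRN lef_pV2 ?posrE ?powR_gt0//; try lra.
      by rewrite ge0_ler_powR ?nnegrE//; lra.
    by rewrite ler_expR; lra.
have h12 : (0 < \int[lebesgue_measure]_(s in `[1%R, 2%R]) (f s)%:E)%E.
  by move: hm; rewrite /Rintegral; case: integral => [r| |]//=; rewrite ltxx.
rewrite /Gamma /Rintegral gt_eqF// fine_gt0// fin andbT.
apply: lt_le_trans h12 _; apply: ge0_subset_integral => //.
  exact: mfS.
by move=> s _; rewrite lee_fin.
Qed.

(** * Limits at infinity and unbounded sequences *)

Lemma limf_esup_pinfty_le (R : realType) (f : R -> \bar R) (A : R) (K : \bar R) :
  (forall t : R, A < t -> (f t <= K)%E) -> (limf_esup f +oo%R <= K)%E.
Proof.
move=> fK; rewrite /limf_esup.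
apply: (@le_trans _ _ (ereal_sup (f @` [set t | A < t]))).
  apply: ereal_inf_lbound; exists [set t | A < t] => //.
  by exists A; split => //; exact: num_real.
by apply: ge_ereal_sup => _ [t /= At <-]; exact: fK.
Qed.

Lemma limf_einf_pinfty_le (R : realType) (f : R -> \bar R) (K : \bar R) :
  (forall A : R, exists t : R, A < t /\ (f t <= K)%E) -> (limf_einf f +oo%R <= K)%E.
Proof.
move=> fK; rewrite /limf_einf leeNl /limf_esup.
apply: le_ereal_inf_tmp => _ [V [A [_ AV]] <-].
have [t [At ft]] := fK A.
apply: (@le_trans _ _ (- f t)%E); first by rewrite leeN2.
by apply: ereal_sup_ubound; exists t => //; exact: AV.
Qed.

(** Each term is taken beyond its predecessor and beyond its own rank, which forces unboundedness.
    Letting [P] depend on the rank accommodates alternating signs. *)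
Lemma increasing_unbounded_choice (R : realType) (P : nat -> R -> Prop) :
  (forall n (A : R), exists t, A < t /\ P n t) ->
  exists T, increasing_unbounded T /\ forall n, P n (T n).
Proof.
move=> h.
have {h}[f fP] : exists f : nat -> R -> R, forall n A, A < f n A /\ P n (f n A).
  have h1 n : exists g : R -> R, forall A, A < g A /\ P n (g A).
    by have [g gP] := choice (h n); exists g.
  by have [g gP] := choice h1; exists g.
pose T := nat_rect (fun=> R) (f 0%N 0) (fun n A => f n.+1 (Num.max A n.+1%:R)).
have T0 n : n%:R < T n.
  case: n => [|n] /=; first by have [] := fP 0%N 0.
  have [+ _] := fP n.+1 (Num.max (T n) n.+1%:R).
  by rewrite gt_max => /andP[].
have TS n : T n < T n.+1.
  have [+ _] := fP n.+1 (Num.max (T n) n.+1%:R).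
  by rewrite gt_max => /andP[].
exists T; split; last by case=> [|n]; [have [] := fP 0%N 0|have [] := fP n.+1 (Num.max (T n) n.+1%:R)].
split.
- by move=> n; apply: le_lt_trans (T0 n).
- exact: homo_ltn lt_trans TS.
- move=> [M Mub]; have := truncnS_gt M.
  have : T (Num.truncn M).+1 <= M by apply: Mub; exists (Num.truncn M).+1.
  by have := T0 (Num.truncn M).+1; lra.
Qed.

(** Beyond its last zeros [x] is positive, so the Riccati estimate applies and keeps the averages of
    [q] below a constant. *)
Lemma caputo_system_not_nonneg (R : realType) (alpha G : R) (q x dx u : R -> R)
    (eps t0 T0 : R) :
  0 < alpha < 1 -> G != 0 -> caputo_system alpha G q x dx u -> 2 < eps -> 0 < t0 ->
  limf_esup (fun t : R => ((t `^ eps)^-1 *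
    \int[lebesgue_measure]_(s in `[t0, t]) ((t - s) `^ eps * q s))%:E)
    (+oo%R : set_system R) = +oo%E ->
  x 0 != 0 -> (forall s : R, T0 < s -> 0 <= x s) ->
  ~ (forall s : R, T0 < s -> 0 <= u s * (dx s - u s)).
Proof.
move=> halpha G0 sys e2 t00 limsup x00 xge prod.
have [[cx cdx xE] cq _ duE] := sys.
have eps0 : 0 < eps by lra.
have eps1 : 0 < eps - 1 by lra.
pose T1 := Num.max T0 t0 + 1.
have T1T0 (s : R) : T1 <= s -> T0 < s.
  by apply: lt_le_trans; rewrite /T1 ltr_pwDr// le_max lexx.
have T1t0 : t0 < T1 by rewrite /T1 ltr_pwDr// le_max lexx orbT.
have [||A [AT1 Apos]] := @caputo_system_large_zeros R alpha G q x dx u T1 halpha G0 sys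
  (lt_trans t00 T1t0) x00.
- by move=> s /T1T0; exact: xge.
- by move=> s /T1T0; exact: prod.
pose T := A + 1.
have TT1 : T1 < T by rewrite /T; lra.
have xpos (s : R) : T <= s -> 0 < x s.
  move=> Ts; rewrite lt0r Apos ?xge//; last by apply: lt_le_trans Ts; rewrite /T; lra.
  by apply: T1T0; exact: le_trans (ltW TT1) Ts.
have Tprod (s : R) : T <= s -> 0 <= u s * (dx s - u s).
  by move=> Ts; apply/prod/T1T0; exact: le_trans (ltW TT1) Ts.
have t0T : t0 < T by exact: lt_trans TT1.
have Tpos : 0 < T by exact: lt_trans t0T.
have [Q Q0 qQ] := continuous_itv_bounded (ltW t0T) cq.
(* The terms bound, after division by t^eps, the integral over [t0, T], the boundary term at [T] and
   the cost of the square. The last one uses t^(eps - 1) <= t^eps, hence the restriction to t >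
   1. *)
pose K := Q * (T - t0) + `|u T / x T| + eps ^+ 2 / 4 / (eps - 1).
have : (limf_esup (fun t : R => ((t `^ eps)^-1 *
    \int[lebesgue_measure]_(s in `[t0, t]) ((t - s) `^ eps * q s))%:E)
    (+oo%R : set_system R) <= K%:E)%E; last by rewrite limsup.
apply: (@limf_esup_pinfty_le R _ (Num.max T 1)) => t.
rewrite gt_max => /andP[Tt t1]; rewrite lee_fin.
have tpos : 0 < t by exact: lt_trans t1.
rewrite ler_pdivrMl ?powR_gt0//.
have intf : lebesgue_measure.-integrable `[t0, t]
    (EFin \o (fun s : R => (t - s) `^ eps * q s)).
  exact: integrable_powRB_continuousM (lt_trans t0T Tt) eps0 cq.
rewrite (Rintegral_itv_split (ltW t0T) (ltW Tt) intf).
have I1 : \int[lebesgue_measure]_(s in `[t0, T]) ((t - s) `^ eps * q s) <=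
    t `^ eps * (Q * (T - t0)).
  have := @Rintegral_le_antiderivative R (fun s : R => (t - s) `^ eps * q s)
    (fun s => t `^ eps * Q * s) (fun=> t `^ eps * Q) t0 T t0T.
  rewrite -mulrBr -mulrA; apply.
  - apply: integrableS intf => //.
    by move=> s /=; rewrite !in_itv/= => /andP[-> sT]; exact: le_trans (ltW Tt).
  - move=> s; rewrite in_itv/= => /andP[_ sT].
    by apply: cvgM; [apply: continuous_powRB; exact: lt_trans Tt|exact: cq].
  - by apply: continuous_subspaceT => s; apply: cvgMr; exact: cvg_id.
  - by move=> s _; apply: is_derive_scaleE (is_derive_id s 1) _; rewrite mulr1.
  - move=> s /andP[st sT]; apply: (@le_trans _ _ ((t - s) `^ eps * Q)).
      rewrite ler_wpM2l ?powR_ge0// (le_trans (ler_norm _))// qQ//.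
      by rewrite (ltW st) (ltW sT).
    rewrite ler_wpM2r// ge0_ler_powR ?nnegrE//; lra.
have tT0 : 0 < t - T by rewrite subr_gt0.
have tTt : t - T <= t by rewrite gerBl ltW.
have I2 := riccati_bound e2 Tpos Tt cq xE duE xpos Tprod.
have p1 : (t - T) `^ eps * (u T / x T) <= t `^ eps * `|u T / x T|.
  apply: (@le_trans _ _ ((t - T) `^ eps * `|u T / x T|)).
    by rewrite ler_wpM2l ?powR_ge0// ler_norm.
  by rewrite ler_wpM2r// ge0_ler_powR ?nnegrE ?(ltW eps0) ?(ltW tT0) ?(ltW tpos).
have p2 : (t - T) `^ (eps - 1) <= t `^ eps.
  apply: (@le_trans _ _ (t `^ (eps - 1))).
    by rewrite ge0_ler_powR ?nnegrE ?(ltW eps1) ?(ltW tT0) ?(ltW tpos).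
  by apply: ler_powR; [exact: ltW|rewrite gerBl].
have c0 : 0 <= eps ^+ 2 / 4 / (eps - 1).
  by rewrite !divr_ge0 ?sqr_ge0 ?(ltW eps1).
have p3 : eps ^+ 2 / 4 / (eps - 1) * (t - T) `^ (eps - 1) <=
    eps ^+ 2 / 4 / (eps - 1) * t `^ eps by rewrite ler_wpM2l.
apply: le_trans (lerD I1 (le_trans I2 (lerD p1 p3))) _.
by rewrite /K !mulrDr addrA (mulrC (_ / _ / _)).
Qed.

(** * From the half-line to the whole line *)

Lemma continuous_extension (R : realType) (f : R -> R) :
  {within `[0, +oo[, continuous f} -> continuous (fun s : R => f (Num.max 0 s)).
Proof.
move=> /subspace_continuousP cf a P fP.
have max0 (s : R) : `[0, +oo[%classic (Num.max 0 s).
  by rewrite /= in_itv/= andbT le_max lexx.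
have cmax : Num.max 0 s @[s --> a] --> Num.max 0 a.
  apply: continuous_max; [exact: cvg_cst|exact: cvg_id].
have h : nbhs a (fun s : R => `[0, +oo[%classic (Num.max 0 s) -> P (f (Num.max 0 s))).
  exact: cmax _ (cf _ (max0 a) P fP).
by move: h; apply: filterS => s; apply; exact: max0.
Qed.

Lemma quotient_continuous_within (R : realType) (x dx : R -> R) :
  (forall t : R, 0 <= t ->
    (x s - x t) / (s - t) @[s --> within `[0, +oo[ t^'] --> dx t) ->
  {within `[0, +oo[, continuous x}.
Proof.
move=> xE; apply/subspace_continuousP => t /=; rewrite in_itv/= andbT => t0.
have h1 : s - t @[s --> within `[0, +oo[ t^'] --> (0 : R).
  rewrite -(subrr t); apply: cvgB; last exact: cvg_cst.
  by apply: cvg_within_filter; apply: cvg_within_filter; exact: cvg_id.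
have h2 : (x s - x t) / (s - t) * (s - t) @[s --> within `[0, +oo[ t^'] --> dx t * 0.
  by apply: cvgM; [exact: xE|exact: h1].
have h : (x s - x t) / (s - t) * (s - t) + x t @[s --> within `[0, +oo[ t^'] -->
    dx t * 0 + x t.
  by apply: cvgD; [exact: h2|exact: cvg_cst].
rewrite mulr0 add0r in h.
move=> P xP.
have : nbhs t (fun s : R => s != t -> `[0, +oo[%classic s ->
    P ((x s - x t) / (s - t) * (s - t) + x t)) by exact: h P xP.
move=> /nbhs_ballP[e /= e0 He].
suff : nbhs t (fun s : R => `[0, +oo[%classic s -> P (x s)) by [].
apply/nbhs_ballP; exists e => //= s /He hs As.
have [->|st] := eqVneq s t; first exact: nbhs_singleton xP.
by have := hs st As; rewrite divfK ?subr_eq0// subrK.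
Qed.

Lemma quotient_is_derive (R : realType) (x dx : R -> R) (t : R) : 0 < t ->
  (x s - x t) / (s - t) @[s --> within `[0, +oo[ t^'] --> dx t ->
  is_derive t 1 x (dx t).
Proof.
move=> t0 xE.
have shift : h + t @[h --> 0^'] --> within `[0, +oo[ t^'.
  move=> P /nbhs_ballP[e /= e0 He].
  (* A radius at most [t] keeps h + t in the half-line. *)
  apply/nbhs_ballP; exists (Num.min e t) => /=; first by rewrite lt_min e0.
  move=> h; rewrite /ball/= sub0r normrN lt_min => /andP[he ht] h0.
  apply: He => /=.
  - by rewrite /ball/= opprD addrCA subrr addr0 normrN.
  - by rewrite -subr_eq0 addrK.
  - by rewrite in_itv/= andbT; move: ht; rewrite ltr_norml; lra.
have h : h^-1 *: (x (h *: 1 + t) - x t) @[h --> 0^'] --> dx t.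
  have := cvg_comp _ _ shift xE.
  apply: cvg_trans; apply: near_eq_cvg; near=> h.
  by rewrite /= addrK /GRing.scale/= mulr1 mulrC.
split; first by apply/cvg_ex; exists (dx t).
exact: cvg_lim h.
Unshelve. all: by end_near. Qed.

(** Composition with max(0, s) makes [q], [x] and the derivative continuous everywhere and changes
    nothing at positive times, where the equation lives. *)
Lemma solution_caputo_system (R : realType) (alpha : R) (q x : R -> R) :
  0 < alpha < 1 -> {within `[0, +oo[, continuous q} -> is_solution alpha q x ->
  exists dx : R -> R, (forall t : R, 0 < t -> derive1 x t = dx t) /\
    caputo_system alpha (Gamma (1 - alpha))^-1 (fun s => q (Num.max 0 s))
      (fun s => x (Num.max 0 s)) dx (caputo alpha x).
Proof.
move=> halpha cq [[dx0 [cdx xE]] sol].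
have max_pos (t : R) : 0 < t -> Num.max 0 t = t by move=> t0; apply/max_idPr; exact: ltW.
have cx := quotient_continuous_within xE.
have dE (t : R) : 0 < t -> is_derive t 1 x (dx0 t).
  by move=> t0; apply: (quotient_is_derive t0); apply: xE; exact: ltW.
have d1E (t : R) : 0 < t -> derive1 x t = dx0 (Num.max 0 t).
  by move=> t0; rewrite derive1E max_pos//; have [_ ->] := dE t t0.
have cdx' := continuous_extension cdx.
exists (fun s => dx0 (Num.max 0 s)); split => //; split.
- split; [exact: continuous_extension|by []|].
  move=> t t0; rewrite max_pos//.
  apply: (near_eq_is_derive _ (dE t t0)).
  near=> s; rewrite max_pos//; near: s; exact: lt_nbhsr.
- exact: continuous_extension.
- move=> t t0; rewrite /caputo; congr (_ * _).
  have [a0 a1] := andP halpha.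
  have intf := @integrable_abel R alpha _ 0 t t a1 t0 (lexx t) cdx'.
  transitivity (\int[lebesgue_measure]_(s in `]0, t[)
      (dx0 (Num.max 0 s) * (t - s) `^ (- alpha))).
    apply: eq_Rintegral => s; rewrite inE/= in_itv/= => /andP[s0 _].
    by rewrite d1E// powRN.
  rewrite Rintegral_itv_bndo_bndc; last first.
    by apply: integrableS intf => //; apply: subset_itv; rewrite bnd_simp.
  rewrite Rintegral_itv_obnd_cbnd//.
  by apply: integrableS intf => //; apply: subset_itv; rewrite bnd_simp.
- move=> t t0; have [du uE] := sol t t0.
  split => //; rewrite -derive1E max_pos//; lra.
Unshelve. all: by end_near. Qed.

(** For the zero solution the product vanishes at all positive times, so the sequence of strict
    inequalities is claimed for solutions that are nonzero somewhere on the half-line. *)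
Theorem theorem1 (R : realType) (alpha : R) (q : R -> R) (eps t0 : R)
  (halpha : 0 < alpha < 1)
  (hq : {within `[0, +oo[, continuous q})
  (heps : 2 < eps) (ht0 : 0 < t0)
  (hlimsup :
    limf_esup (fun t : R =>
      ((t `^ eps)^-1 *
       \int[lebesgue_measure]_(s in `[t0, t]) ((t - s) `^ eps * q s))%:E)
      (+oo%R : set_system R) = +oo%E)
  (x : R -> R) (hx : is_solution alpha q x) :
  oscillates x \/
  ((limf_einf (fun t : R =>
      (caputo alpha x t * (derive1 x t - caputo alpha x t))%:E)
      (+oo%R : set_system R) <= 0)%E /\
   ((exists2 t : R, 0 <= t & x t != 0) ->
    exists T : nat -> R,
      increasing_unbounded T /\
      forall n, caputo alpha x (T n) * (derive1 x (T n) - caputo alpha x (T n)) < 0)).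
Proof.
have [dx [dxE sys]] := solution_caputo_system halpha hq hx.
set q' := (fun s : R => q (Num.max 0 s)) in sys.
set x' := (fun s : R => x (Num.max 0 s)) in sys.
have max_pos (t : R) : 0 <= t -> Num.max 0 t = t by move=> tp; exact/max_idPr.
set u := caputo alpha x in sys *.
have G0 : (Gamma (1 - alpha))^-1 != 0.
  by rewrite invr_eq0 Gamma_neq0//; lra.
have limsup' : limf_esup (fun t : R => ((t `^ eps)^-1 *
    \int[lebesgue_measure]_(s in `[t0, t]) ((t - s) `^ eps * q' s))%:E)
    (+oo%R : set_system R) = +oo%E.
  rewrite -hlimsup; congr (limf_esup _ _); apply/funext => t; congr (_ * _)%:E.
  apply: eq_Rintegral => s; rewrite inE/= in_itv/= => /andP[ts _].
  by rewrite /q' max_pos// (le_trans (ltW ht0)).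
have [x00|x00] := eqVneq (x' 0) 0.
  right; have x0 (t : R) : 0 <= t -> x' t = 0.
    exact: (caputo_system_unique halpha G0 sys x00).
  (* Every point is a maximum of both x and - x, so [abel_ge_max] gives the two opposite
     inequalities. *)
  have u0 (t : R) : 0 < t -> u t = 0.
    move=> tpos; have [xC1 _ uE _] := sys.
    have [_ cdx _] := xC1.
    have J1 := @abel_ge_max R alpha x' dx t halpha tpos xC1.
    have J2 := @abel_ge_max R alpha (\- x') (\- dx) t halpha tpos (C1_positiveN xC1).
    rewrite uE//; apply/eqP; rewrite mulf_eq0 (negbTE G0)/= eq_le.
    rewrite abel_integralN// in J2.
    move: J1 J2; rewrite /= (x0 t (ltW tpos)) (x0 0 (lexx 0)) ?oppr0 ?addr0 ?mul0r.
    move=> J1 J2; apply/andP; split.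
      rewrite -oppr_ge0; apply: J2 => s /andP[s0 _]; by rewrite x0 ?oppr0.
    by apply: J1 => s /andP[s0 _]; rewrite x0.
  split; last first.
    by move=> [t tpos]; have := x0 t tpos; rewrite /x' max_pos// => ->; rewrite eqxx.
  apply: limf_einf_pinfty_le => A; exists (Num.max A 0 + 1).
  have h : 0 < Num.max A 0 + 1 by rewrite ltr_pwDr// le_max lexx orbT.
  by rewrite u0// mul0r ltr_pwDr ?le_max ?lexx.
have [osc|nosc] := pselect (oscillates x); first by left.
right.
(* Without a constant sign eventually, both strict signs recur arbitrarily far, and choosing them
   alternately, negative at even ranks, would make [x] oscillate. *)
have sign : exists A : R,
    (forall t : R, A < t -> 0 <= x' t) \/ (forall t : R, A < t -> x' t <= 0).
  apply: contrapT => nsign; apply: nosc.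
  have far (n : nat) (A : R) : exists t : R, A < t /\
      (if odd n then 0 < x t else x t < 0).
    apply: contrapT => nfar; apply: nsign; exists (Num.max A 0).
    case: (odd n) nfar => nfar; [right|left] => t; rewrite gt_max => /andP[At tpos];
      rewrite /x' max_pos ?(ltW tpos)// leNgt; apply/negP => xt;
      by apply: nfar; exists t.
  have [T [Tinc TP]] := increasing_unbounded_choice far.
  exists T; split => // n; split.
    by have := TP n.*2; rewrite odd_double.
  by have := TP n.*2.+1; rewrite /= odd_double.
(* The product is invariant under x -> - x, so an eventually nonpositive [x] reduces to the
   nonnegative case. *)
have far (A : R) : exists t : R, A < t /\ u t * (derive1 x t - u t) < 0.
  apply: contrapT => nfar.
  have prod (t : R) : Num.max A 0 < t -> 0 <= u t * (dx t - u t).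
    rewrite gt_max => /andP[At tpos]; rewrite leNgt; apply/negP => ut.
    by apply: nfar; exists t; rewrite dxE.
  have [B [xB|xB]] := sign.
  - apply: (@caputo_system_not_nonneg R alpha _ q' x' dx u eps t0 (Num.max B (Num.max A 0))
      halpha G0 sys heps ht0 limsup' x00).
      by move=> s; rewrite gt_max => /andP[Bs _]; exact: xB.
    by move=> s; rewrite gt_max => /andP[_ As]; exact: prod.
  - apply: (@caputo_system_not_nonneg R alpha _ q' (\- x') (\- dx) (\- u) eps t0
      (Num.max B (Num.max A 0)) halpha G0 (caputo_systemN halpha sys) heps ht0 limsup').
    + by rewrite /= oppr_eq0.
    + by move=> s; rewrite gt_max /= oppr_ge0 => /andP[Bs _]; exact: xB.
    + by move=> s; rewrite gt_max => /andP[_ As]; rewrite /= -opprD mulrNN; exact: prod.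
split.
  apply: limf_einf_pinfty_le => A; have [t [At ut]] := far A.
  by exists t; rewrite lee_fin ltW.
by move=> _; exact: (@increasing_unbounded_choice R (fun _ t => u t * (derive1 x t - u t) < 0)).
Qed.
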